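(* Let $\ell:(0,\infty)\to(0,\infty)$ be a smooth, slowly varying, monotonically decreasing function with $\lim_{t\to\infty}\ell(t)=0$ and $0<\ell(k)<1$ for every integer $k\ge1$. Consider a sequence of independent tosses of biased coins in which the $k$-th toss ($k=1,2,3,\dots$) gives tails with probability $\ell(k)$ and heads with probability $1-\ell(k)$. Let $R_n$ be the length of the longest run of consecutive heads among the first $n$ tosses, let $\Pi(n)$ be the total number of tails observed during the first $n$ tosses, and let $$E\Pi(n)=\sum_{k=1}^{n}\ell(k)$$ be its mathematical expectation. Then there exist real sequences $a_n>0$ and $b_n$ with $$a_n\sim\frac{n}{E\Pi(n)},\qquad b_n\sim\frac{n\log E\Pi(n)}{E\Pi(n)}\qquad(n\to\infty)$$ such that for every real $z$ $$\lim_{n\to\infty}P(R_n\le a_n z+b_n)=\exp(-e^{-z}).$$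
   Context: A function $\ell(t)>0$ defined for positive $t$ is called slowly varying if $\lim_{t\to\infty}\frac{\ell(\lambda t)}{\ell(t)}=1$ for every fixed $\lambda>0$. The notation $u_n\sim v_n$ means $u_n/v_n\to1$ as $n\to\infty$; $\log$ is the natural logarithm. Runs of length $0$ are allowed, so $R_n=0$ if there are no heads among the first $n$ tosses. *)

(* Defs.v *)
From HB Require Import structures.
From mathcomp Require Import all_boot all_order all_algebra.
From mathcomp Require Import all_classical all_reals all_analysis.

Set Implicit Arguments.
Unset Strict Implicit.
Unset Printing Implicit Defensive.

Import Order.TTheory GRing.Theory Num.Theory.
Import numFieldNormedType.Exports.

Local Open Scope classical_set_scope.
Local Open Scope ring_scope.

(* Functions on (0, +oo) are total functions [R -> R] of which only the values
   at positive arguments matter. *)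

Definition slowly_varying (R : realType) (l : R -> R) : Prop :=
  forall lam : R, 0 < lam -> l (lam * t) / l t @[t --> +oo] --> (1 : R).

(* [derive1n n l] at t depends only on l near t, so this is C^infty on the open
   half-line whatever the values of l elsewhere. *)
Definition smooth_on_pos (R : realType) (l : R -> R) : Prop :=
  forall (n : nat) (t : R), 0 < t -> derivable (derive1n n l) t 1.

Definition asymp_equiv (R : realType) (u v : nat -> R) : Prop :=
  u n / v n @[n --> \oo] --> (1 : R).

(* Mutual independence of the random variables X k, k in D. *)
Definition mutually_independent (R : realType) (d d' : measure_display)
    (T : measurableType d) (T' : measurableType d') (P : probability T R)
    (I : eqType) (D : set I) (X : I -> {RV P >-> T'}) : Prop :=
  forall (s : seq I) (B : I -> set T'),
    uniq s -> (forall k, k \in s -> D k) ->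
    (forall k, k \in s -> measurable (B k)) ->
    P (\big[setI/setT]_(k <- s) (X k @^-1` B k)) =
    (\prod_(k <- s) P (X k @^-1` B k))%E.

(* A toss is a boolean, [true] meaning tails.  Tosses are numbered from 1; the
   value at index 0 is never used. *)

(* The largest m such that, for some i with i + m <= n, the tosses
   i + 1, ..., i + m are all heads. *)
Definition longest_head_run (toss : nat -> bool) (n : nat) : nat :=
  (\max_(m < n.+1 | [exists i : 'I_n.+1,
     (i + m <= n)%N && [forall j : 'I_m, ~~ toss (i + j).+1]]) m)%N.

Definition num_tails (toss : nat -> bool) (n : nat) : nat :=
  (\sum_(1 <= k < n.+1) toss k)%N.

(* Main.v *)
Require Import Defs.
From HB Require Import structures.
From mathcomp Require Import all_boot all_order all_algebra.
From mathcomp Require Import all_classical all_reals all_analysis.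
From mathcomp Require Import measurable_realfun ring lra zify.

Set Implicit Arguments.
Unset Strict Implicit.
Unset Printing Implicit Defensive.

Import Order.TTheory GRing.Theory Num.Theory.
Import numFieldNormedType.Exports.

Local Open Scope classical_set_scope.
Local Open Scope ring_scope.

(* Let toss 0 be a sure tail, so that every head run follows a tail, and let Q n
   be the probability that the first n tosses contain no r consecutive heads.
   Splitting according to the end k of the first such run gives the exact
   recurrence Q k = Q (k-1) - c k * Q (k-r-1), where c k is the probability of a
   tail at k-r followed by r heads.  As Q is nonincreasing and varies over r
   steps by at most a window sum s of c, this forces
   exp (-L) - s L <= Q n <= exp (-L) with L = sum_(k <= n) c k.
   If r is about log (E Pi(n)) / l(n) and L stays bounded, then s -> 0. Choosing
   b n as the largest r with L >= 1 gives L -> 1, and slow variation of l shows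
   that lengthening r by z / l(n) multiplies L by exp (-z) asymptotically: the
   terms of L at small indices are negligible by Chebyshev's sum inequality, and
   on the others l is nearly constant.  Hence a n = 1 / l(n), and Karamata's
   theorem E Pi(n) ~ n l(n) gives the stated form of a and b. *)

(** * Runs of heads *)

Definition head_run (toss : nat -> bool) (i r : nat) : bool :=
  [forall j : 'I_r, ~~ toss (i + j).+1].

Lemma head_runP (toss : nat -> bool) (i r : nat) :
  reflect (forall k, (i < k <= i + r)%N -> ~~ toss k) (head_run toss i r).
Proof.
apply: (iffP forallP) => [hi k /andP[ik kir]|hi j]; last first.
  by apply: hi; have := ltn_ord j; lia.
have kr : (k - i.+1 < r)%N by lia.
by have := hi (Ordinal kr); rewrite /= -addSn subnKC.
Qed.

(** A run of length [m] contains runs of all smaller lengths from the same start, so the maximum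
    over exact lengths turns into an existential statement. *)
Lemma leq_longest_head_run (toss : nat -> bool) (n r : nat) :
  (r <= longest_head_run toss n)%N <->
  exists2 i, (i + r <= n)%N & head_run toss i r.
Proof.
rewrite /longest_head_run; split => [|[i irn hi]]; last first.
  have rn : (r < n.+1)%N by lia.
  have i_n : (i < n.+1)%N by lia.
  have -> : r = Ordinal rn by [].
  apply: (@leq_bigmax_cond _ _ (fun m : 'I_n.+1 => nat_of_ord m)).
  by apply/existsP; exists (Ordinal i_n); rewrite irn.
case: r => [_|r rle].
  by exists 0%N => //; apply/head_runP => k; lia.
have [m /existsP[i /andP[imn /head_runP hi]] rm] :
    exists2 m : 'I_n.+1, [exists i : 'I_n.+1,
     (i + m <= n)%N && head_run toss i m] & (r < m)%N.
  apply/exists_inP; apply: contraLR rle => /exists_inPn noex.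
  by rewrite -leqNgt; apply/bigmax_leqP => m /noex; rewrite -leqNgt.
by exists i; [lia|apply/head_runP => k kir; apply: hi; lia].
Qed.

(* The first run of length [r], if it ends at [n.+1], is preceded by a tail at
   [n.+1 - r]; toss 0 acts as a tail. *)
Lemma longest_head_run_ltS (toss : nat -> bool) (r n : nat) : (0 < r)%N ->
  (longest_head_run toss n.+1 < r)%N =
  (longest_head_run toss n < r)%N &&
  ~~ [&& (longest_head_run toss (n - r) < r)%N, (r <= n.+1)%N,
         (n.+1 - r == 0)%N || toss (n.+1 - r)%N & head_run toss (n.+1 - r) r].
Proof.
move=> r0; apply/idP/idP.
  rewrite !ltnNge => hn1; apply/andP; split.
    apply: contra hn1 => /leq_longest_head_run[i irn hi].
    by apply/leq_longest_head_run; exists i => //; lia.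
  apply: contra hn1 => /and4P[_ rn _ hi].
  by apply/leq_longest_head_run; exists (n.+1 - r)%N => //; lia.
move=> /andP[hn]; apply: contraR; rewrite -leqNgt => /leq_longest_head_run.
move=> [i irn hi].
have noshort : forall i', (i' + r <= n)%N -> ~~ head_run toss i' r.
  move=> i' i'n; apply/negP => hi'; move: hn; rewrite ltnNge => /negP; apply.
  by apply/leq_longest_head_run; exists i'.
have iE : (i + r = n.+1)%N.
  have /contraTN/(_ hi) := noshort i; lia.
have -> : (n.+1 - r = i)%N by lia.
rewrite hi andbT; apply/and3P; split; last 2 first.
- lia.
- case: (posnP i) => [//|i0] /=; apply/negPn/negP => ti.
  have /negP := noshort i.-1 ltac:(lia); apply; apply/head_runP => k kir.
  case: (eqVneq k i) => [->//|ki].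
  by move/head_runP: hi; apply; lia.
- rewrite ltnNge; apply/negP => /leq_longest_head_run[i' i'n].
  by apply/negP; apply: noshort; lia.
Qed.

(** The preceding tail separates: a run of length [r] within the first [n] tosses would either end
    by [n - r] or contain toss [n.+1 - r]. When [n.+1 - r] is 0, no such run fits. *)
Lemma longest_head_run_lt_first (toss : nat -> bool) (r n : nat) :
  (0 < r)%N -> (r <= n.+1)%N ->
  (longest_head_run toss (n - r) < r)%N ->
  (n.+1 - r == 0)%N || toss (n.+1 - r)%N ->
  (longest_head_run toss n < r)%N.
Proof.
move=> r0 rn hnr ht; rewrite ltnNge; apply/negP => /leq_longest_head_run.
move=> [i irn hi]; case/orP: ht => [|ht]; first by lia.
have [irnr|irnr] := leqP (i + r) (n - r).
  move: hnr; rewrite ltnNge => /negP; apply.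
  by apply/leq_longest_head_run; exists i.
by move/head_runP: hi => /(_ (n.+1 - r)%N ltac:(lia)); rewrite ht.
Qed.

Definition heads_prob (R : realType) (q : nat -> R) (i r : nat) : R :=
  \prod_(j < r) (1 - q (i + j).+1).

(* The probability that a tail at time [k - r] (time 0 counting as a tail) is
   followed by a run of [r] heads ending at time [k]. *)
Definition run_end_prob (R : realType) (q : nat -> R) (r k : nat) : R :=
  if (r <= k)%N then q (k - r)%N * heads_prob q (k - r) r else 0.

(** * Recurrence for the probability of no run of [r] heads *)

Section RunProbability.
Variables (R : realType) (q : nat -> R) (d : measure_display).
Variables (T : measurableType d) (P : probability T R).
Variable X : nat -> {RV P >-> bool}.
Hypothesis X_indep : mutually_independent [set k | (1 <= k)%N] X.
Hypothesis q0 : q 0%N = 1.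
Hypothesis X_tails : forall k, (1 <= k)%N ->
  P (X k @^-1` [set true]) = (q k)%:E.
Hypothesis X_heads : forall k, (1 <= k)%N ->
  P (X k @^-1` [set false]) = (1 - q k)%:E.

Definition no_head_run (r n : nat) : set T :=
  [set w | (longest_head_run (fun k => X k w) n < r)%N].

Let cylinder (s : seq nat) (B : nat -> set bool) : set T :=
  \big[setI/setT]_(k <- s) (X k @^-1` B k).

(** Index 0 is left out because independence covers the indices from 1 on; the sure tail there
    enters through [q 0 = 1]. *)
Let first_run_support (i r : nat) : seq nat :=
  [seq k <- iota i r.+1 | (0 < k)%N].

(** A singleton: [true] (tails) at [i], [false] (heads) at every other index. *)
Let first_run_values (i k : nat) : set bool := [set k == i].

Let cylinderP s B w : cylinder s B w <-> (forall k, k \in s -> B k (X k w)).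
Proof. by rewrite /cylinder -bigcap_seq; split => h k; apply: h. Qed.

Let measurable_cylinder s B : measurable (cylinder s B).
Proof.
apply: bigsetI_measurable => k _; rewrite -[_ @^-1` _]setTI.
exact: measurable_funP.
Qed.

Let toss_prob (k : nat) (b : set bool) : R := fine (P (X k @^-1` b)).

Let prob_cylinder s B : uniq s -> (forall k, k \in s -> (0 < k)%N) ->
  P (cylinder s B) = (\prod_(k <- s) toss_prob k (B k))%:E.
Proof.
move=> us s0; rewrite /cylinder X_indep // -prodEFin.
apply: eq_bigr => k _; rewrite fineK // fin_num_measure //.
by rewrite -[_ @^-1` _]setTI; apply: measurable_funP.
Qed.

Let prob_first_run i r :
  \prod_(k <- first_run_support i r) toss_prob k (first_run_values i k) =
  q i * heads_prob q i r.
Proof.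
have -> : heads_prob q i r =
    \prod_(k <- iota i.+1 r) toss_prob k (first_run_values i k).
  have -> : iota i.+1 r = index_iota (0 + i.+1) (r + i.+1).
    by rewrite /index_iota add0n addnK.
  rewrite /heads_prob big_addn addnK big_mkord; apply: eq_bigr => j _.
  rewrite /toss_prob /first_run_values.
  have -> : (j + i.+1 == i)%N = false by lia.
  by rewrite X_heads ?addnS// addnC.
have nz j : [seq k <- iota j.+1 r | (0 < k)%N] = iota j.+1 r.
  by apply/all_filterP/allP => k; rewrite mem_iota; lia.
rewrite /first_run_support /=; case: i => [|i] /=; rewrite nz ?q0 ?mul1r//.
by rewrite big_cons {1}/toss_prob /first_run_values eqxx X_tails.
Qed.

Let no_head_runS r n : (0 < r)%N ->
  no_head_run r n.+1 = no_head_run r n `\`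
    (if (r <= n.+1)%N then
      no_head_run r (n - r) `&` cylinder (first_run_support (n.+1 - r) r)
                                         (first_run_values (n.+1 - r))
     else set0).
Proof.
move=> r0; apply/seteqP; split => w /=; rewrite /no_head_run /=.
  rewrite longest_head_run_ltS// => /andP[-> h]; split => //.
  case: ifP => //= rn hE; case: hE => hnr hc; move/cylinderP: hc => hc.
  move/negP: h; apply.
  rewrite hnr rn andTb andTb; apply/andP; split.
    case: (posnP (n.+1 - r)) => //= n0.
    have := hc (n.+1 - r)%N; rewrite mem_filter mem_iota n0 /first_run_values.
    by rewrite eqxx; apply; lia.
  apply/head_runP => k kir; have := hc k; rewrite mem_filter mem_iota.
  rewrite /first_run_values /= => -> //; lia.
move=> [hn h]; rewrite longest_head_run_ltS// hn /=; apply/negP.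
move=> /and4P[hnr rn ht /head_runP hh]; move: h; rewrite rn; apply; split => //.
apply/cylinderP => k; rewrite mem_filter mem_iota /first_run_values /=.
case: (eqVneq k (n.+1 - r)%N) => [-> nr|kn kr].
  by move: ht; case/orP => //; lia.
by apply/negbTE/hh; lia.
Qed.

(** The induction invariant. Testing independence on cylinders over finitely many later tosses is
    enough for the recurrence, so no generated sigma-algebra enters. *)
Let indep_of_future r n :=
  measurable (no_head_run r n) /\
  forall s B, uniq s -> (forall k, k \in s -> (n < k)%N) ->
    P (no_head_run r n `&` cylinder s B) =
    (fine (P (no_head_run r n)) * \prod_(k <- s) toss_prob k (B k))%:E.

(** Taking [s] empty yields the recurrence; inserting the recurrence for general [s] yields the
    invariant at [n.+1]. *)
Let indep_step r n : (0 < r)%N ->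
  indep_of_future r n -> indep_of_future r (n - r) ->
  measurable (no_head_run r n.+1) /\
  forall s B, uniq s -> (forall k, k \in s -> (n.+1 < k)%N) ->
    P (no_head_run r n.+1 `&` cylinder s B) =
    ((fine (P (no_head_run r n)) -
      run_end_prob q r n.+1 * fine (P (no_head_run r (n - r)))) *
     \prod_(k <- s) toss_prob k (B k))%:E.
Proof.
move=> r0 [mn indn] [mnr indnr].
rewrite no_head_runS// /run_end_prob; case: ifP => rn; last first.
  rewrite setD0 mul0r subr0; split => // s B us sn.
  by apply: indn => // k /sn; exact: ltnW.
set C0 := cylinder _ _.
have mE : measurable (no_head_run r (n - r) `&` C0).
  by apply: measurableI => //; exact: measurable_cylinder.
(* The removed event lies inside [no_head_run r n], so the probability of the set difference is a
   difference of probabilities. *)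
have subE : no_head_run r (n - r) `&` C0 `<=` no_head_run r n.
  move=> w [hw /cylinderP hc]; apply: (longest_head_run_lt_first r0 rn) => //.
  case: (posnP (n.+1 - r)%N) => //= n0; have := hc (n.+1 - r)%N.
  rewrite mem_filter mem_iota n0 /first_run_values /= eqxx; apply; lia.
have ind0 s B : uniq s -> (forall k, k \in s -> (n.+1 < k)%N) ->
    P (no_head_run r (n - r) `&` C0 `&` cylinder s B) =
    (fine (P (no_head_run r (n - r))) *
      (q (n.+1 - r)%N * heads_prob q (n.+1 - r) r) *
     \prod_(k <- s) toss_prob k (B k))%:E.
  move=> us sn; set i := (n.+1 - r)%N.
  (* [B'] glues the two prescriptions, whose index sets are disjoint, into one cylinder based beyond
     [n - r], where the invariant at [n - r] applies. If [r = n + 1], this holds because index 0 was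
     filtered out. *)
  pose B' k := if (k <= n.+1)%N then first_run_values i k else B k.
  have B'1 k : k \in first_run_support i r -> B' k = first_run_values i k.
    by rewrite mem_filter mem_iota /B' => h; case: ifP => //; lia.
  have B'2 k : k \in s -> B' k = B k.
    by move=> /sn kn; rewrite /B'; case: ifP => //; lia.
  have -> : no_head_run r (n - r) `&` C0 `&` cylinder s B =
      no_head_run r (n - r) `&` cylinder (first_run_support i r ++ s) B'.
    rewrite -setIA; congr (_ `&` _); rewrite /cylinder big_cat /=.
    rewrite /C0 /cylinder; congr (_ `&` _).
      by apply: eq_big_seq => k ks; rewrite B'1.
    by apply: eq_big_seq => k ks; rewrite B'2.
  rewrite indnr; last 2 first.
  - rewrite cat_uniq us filter_uniq ?iota_uniq//= andbT.
    apply/hasPn => k /sn kn; rewrite mem_filter mem_iota; lia.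
  - move=> k; rewrite mem_cat mem_filter mem_iota => /orP[|/sn]; lia.
  rewrite -mulrA; congr (_ * _)%:E; rewrite big_cat /= -prob_first_run.
  congr (_ * _).
    by apply: eq_big_seq => k ks; rewrite B'1.
  by apply: eq_big_seq => k ks; rewrite B'2.
split=> [|s B us sn]; first exact: measurableD.
have mC := measurable_cylinder s B.
rewrite setIDAC setIDA measureD//; last 2 first.
- exact: measurableI.
- by rewrite ltey_eq fin_num_measure//; exact: measurableI.
rewrite -setIA (setIC (cylinder _ _)) setIA (setIidr subE).
rewrite mulrBl EFinB; congr (_ - _)%E; last first.
  by rewrite [X in X * _]mulrC; exact: ind0.
by apply: indn => // k /sn; exact: ltnW.
Qed.

Let no_head_run0 r : (0 < r)%N -> no_head_run r 0 = setT.
Proof.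
move=> r0; apply/seteqP; split => // w _; rewrite /no_head_run /= ltnNge.
by apply/negP => /leq_longest_head_run[i]; lia.
Qed.

Let prob_no_head_run0 r : (0 < r)%N -> fine (P (no_head_run r 0)) = 1.
Proof. by move=> r0; rewrite no_head_run0// probability_setT. Qed.

Let prob_no_head_runS r n : (0 < r)%N ->
  indep_of_future r n -> indep_of_future r (n - r) ->
  fine (P (no_head_run r n.+1)) = fine (P (no_head_run r n)) -
    run_end_prob q r n.+1 * fine (P (no_head_run r (n - r))).
Proof.
move=> r0 hn hnr; have [_ /(_ [::] (fun=> setT) isT)] := indep_step r0 hn hnr.
by rewrite /cylinder !big_nil setIT mulr1 => ->.
Qed.

Let no_head_run_indep r n : (0 < r)%N -> indep_of_future r n.
Proof.
move=> r0; elim/ltn_ind: n => -[_|n IH].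
  split=> [|s B us s0]; first by rewrite no_head_run0.
  by rewrite prob_no_head_run0// no_head_run0// setTI prob_cylinder// mul1r.
have hn := IH n (ltnSn n); have hnr := IH (n - r)%N ltac:(lia).
have [mn hcyl] := indep_step r0 hn hnr; split => // s B us sn.
by rewrite hcyl// prob_no_head_runS.
Qed.

Lemma measurable_no_head_run r n : (0 < r)%N -> measurable (no_head_run r n).
Proof. by move=> /(no_head_run_indep n)[]. Qed.

Lemma no_head_run_recurrence r : (0 < r)%N ->
  fine (P (no_head_run r 0)) = 1 /\
  forall n, fine (P (no_head_run r n.+1)) = fine (P (no_head_run r n)) -
    run_end_prob q r n.+1 * fine (P (no_head_run r (n - r))).
Proof.
move=> r0; split=> [|n]; first exact: prob_no_head_run0.
by apply: prob_no_head_runS => //; exact: no_head_run_indep.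
Qed.
End RunProbability.

Lemma expectation_num_tails (R : realType) (d : measure_display)
    (T : measurableType d) (P : probability T R) (X : nat -> {RV P >-> bool})
    (p : nat -> R) (n : nat) :
  (forall k, (1 <= k)%N -> P (X k @^-1` [set true]) = (p k)%:E) ->
  ('E_P[fun w => (num_tails (fun k => X k w) n)%:R] =
   (\sum_(1 <= k < n.+1) p k)%:E)%E.
Proof.
move=> X_tails.
have mX k : measurable (X k @^-1` [set true]).
  by rewrite -[_ @^-1` _]setTI; exact: measurable_funP.
rewrite unlock (_ : (fun _ => _) =
    fun w => (\sum_(1 <= k < n.+1) (\1_(X k @^-1` [set true]) w)%:E)%E).
  rewrite ge0_integral_sum//; last first.
    move=> k; exact/measurable_EFinP/measurable_indic.
  rewrite -sumEFin; apply: eq_big_nat => k /andP[k1 _].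
  rewrite integral_indic// setIT; exact: X_tails.
apply/funext => w; rewrite /num_tails natr_sum -sumEFin.
apply: eq_bigr => k _; rewrite indicE; congr (nat_of_bool _)%:R%:E.
by apply/idP/idP => [Xkw|/set_mem//]; exact/mem_set.
Qed.

(** * Exponential bounds for a delayed recurrence *)

Section Sandwich.
Variables (R : realType) (c Q : nat -> R) (r : nat).
Hypothesis c0 : forall k, 0 <= c k.
Hypothesis Q0 : Q 0%N = 1.
Hypothesis QS : forall n, Q n.+1 = Q n - c n.+1 * Q (n - r)%N.
Hypothesis Q_ge0 : forall n, 0 <= Q n.

Let Q_noninc m n : (m <= n)%N -> Q n <= Q m.
Proof.
elim: n => [|n IH]; first by rewrite leqn0 => /eqP ->.
rewrite leq_eqVlt => /orP[/eqP->//|]; rewrite ltnS => /IH; apply: le_trans.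
by rewrite QS lerBlDr lerDl mulr_ge0.
Qed.

Let Q_le1 n : Q n <= 1. Proof. by rewrite -Q0 Q_noninc. Qed.

Let Q_telescope m n : (m <= n)%N ->
  Q m <= Q n + \sum_(m <= k < n) c k.+1.
Proof.
elim: n => [|n IH]; first by rewrite leqn0 => /eqP ->; rewrite big_geq// addr0.
rewrite leq_eqVlt => /orP[/eqP->|]; first by rewrite big_geq// addr0.
rewrite ltnS => mn; rewrite big_nat_recr//= QS; apply: le_trans (IH mn) _.
have := ler_piMr (c0 n.+1) (Q_le1 (n - r)); lra.
Qed.

(** Monotonicity replaces [Q (n - r)] by the smaller [Q n], and each step then costs a factor
    [1 - c n.+1 <= expR (- c n.+1)]. *)
Lemma recurrence_le_expR n : Q n <= expR (- \sum_(k < n) c k.+1).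
Proof.
elim: n => [|n IH]; first by rewrite Q0 big_ord0 oppr0 expR0.
rewrite big_ord_recr /= opprD expRD.
have : Q n.+1 <= Q n * (1 - c n.+1).
  by rewrite QS mulrBr mulr1 lerD2l lerN2 mulrC ler_wpM2l// Q_noninc// leq_subr.
move=> /le_trans; apply.
apply: le_trans (ler_wpM2l (Q_ge0 n) (expR_ge1Dx (- c n.+1))) _.
by rewrite ler_wpM2r ?expR_ge0.
Qed.

(** Over the delay [Q] drops by at most the sum [C] of the earlier window terms. With [x = c n.+1],
    replacing [Q (n - r)] by [Q n] costs at most [x * C], and replacing [1 - x] by [expR (- x)] at
    most [x ^+ 2]. Together this is at most [s * x], as the window includes [x] itself. *)
Lemma recurrence_ge_expR s n :
  (forall m, (m < n)%N -> \sum_(m - r <= k < m.+1) c k.+1 <= s) ->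
  expR (- \sum_(k < n) c k.+1) - s * \sum_(k < n) c k.+1 <= Q n.
Proof.
elim: n => [_|n IH hs]; first by rewrite Q0 big_ord0 oppr0 expR0 mulr0 subr0.
have {}IH := IH (fun m mn => hs m (ltnW mn)).
move: (hs n (ltnSn n)); rewrite big_ord_recr /= big_nat_recr ?leq_subr//=.
have := Q_telescope (leq_subr r n).
set C := \sum_(_ <= _ < _) _; set L := \sum_(_ < _) _ in IH *.
set x := c n.+1 => QC Cx; rewrite QS -/x.
have x0 : 0 <= x := c0 _.
have L0 : 0 <= L by apply: sumr_ge0.
(* This follows from [expR (- x) * (1 + x) <= 1] and [(1 + x) * (1 - x + x ^+ 2) = 1 + x ^+ 3]. *)
have ex0 : expR (- x) <= 1 - x + x ^+ 2.
  have : expR (- x) * (1 + x) <= 1.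
    rewrite (le_trans (ler_wpM2l (expR_ge0 (- x)) (expR_ge1Dx x)))//.
    by rewrite -expRD addNr expR0.
  have : 0 <= x ^+ 3 by rewrite exprn_ge0.
  have := expR_ge0 (- x).
  set e := expR _; nra.
rewrite opprD expRD; set E := expR (- L) in IH *.
have E0 : 0 <= E by apply: expR_ge0.
have E1 : E <= 1 by rewrite -(expR0 R) ler_expR oppr_le0.
have s0 : 0 <= s.
  by apply: le_trans Cx; rewrite addr_ge0//; apply: sumr_ge0.
have sL0 : 0 <= s * L by rewrite mulr_ge0.
(* If [1 < x <= s], then [s * x >= 1] already makes the lower bound nonpositive. *)
have [x1|x1] := leP x 1; last first.
  have e1 : E * expR (- x) <= 1 * 1.
    by rewrite ler_pM ?expR_ge0// -(expR0 R) ler_expR; lra.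
  have xs : x <= s by apply: le_trans Cx; rewrite lerDr; apply: sumr_ge0.
  have : 1 * 1 <= s * x by rewrite ler_pM// ?ltW//; apply: lt_le_trans xs.
  have := Q_ge0 n.+1; rewrite QS -/x mulrDr; lra.
have := ler_wpM2l E0 ex0.
have : (E - s * L) * (1 - x) <= Q n * (1 - x) by rewrite ler_wpM2r// subr_ge0.
have := ler_wpM2l x0 QC; have := ler_wpM2l x0 Cx.
have : E * x ^+ 2 <= 1 * x ^+ 2 by rewrite ler_wpM2r// exprn_ge0.
have := mulr_ge0 sL0 x0.
set e := expR _; nra.
Qed.
End Sandwich.

(** * The expected number of long runs *)

Definition partial_sum (R : realType) (q : nat -> R) (n : nat) : R :=
  \sum_(0 <= i < n) q i.

(* The sum of [run_end_prob q r k] over [k <= n]. *)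
Definition mean_runs (R : realType) (q : nat -> R) (r n : nat) : R :=
  \sum_(0 <= i < n.+1 - r) q i * heads_prob q i r.

(** With [y = x / (1 - x)] one has [1 + y = (1 - x)^-1], so this is [1 + y <= expR y] inverted. *)
Lemma expR_frac_le1B (R : realType) (x : R) : x < 1 ->
  expR (- (x / (1 - x))) <= 1 - x.
Proof.
move=> x1; have x'0 : 0 < 1 - x by rewrite subr_gt0.
rewrite -[leRHS]invrK -lef_pV2 ?posrE ?expR_gt0 ?invr_gt0// invrK expRN invrK.
apply: le_trans (expR_ge1Dx _).
by rewrite -[leLHS]mul1r ler_pdivrMr// mulrDl divfK ?lt0r_neq0// mul1r subrK.
Qed.

Section MeanRuns.
Variables (R : realType) (q : nat -> R).
Hypothesis q_gt0 : forall k, 0 < q k.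
Hypothesis q_lt1 : forall k, (0 < k)%N -> q k < 1.
Hypothesis q_noninc : forall m n, (m <= n)%N -> q n <= q m.

Local Notation p := (heads_prob q).
Local Notation S := (partial_sum q).

Let q_ge0 k : 0 <= q k. Proof. exact: ltW. Qed.

Lemma heads_prob_gt0 i r : 0 < p i r.
Proof. by apply: prodr_gt0 => j _; rewrite subr_gt0 q_lt1. Qed.

Let p_ge0 i r : 0 <= p i r. Proof. exact: ltW (heads_prob_gt0 i r). Qed.

Lemma heads_probD i r s : p i (r + s) = p i r * p (i + r) s.
Proof.
rewrite /heads_prob big_split_ord /=; congr (_ * _).
by apply: eq_bigr => j _; rewrite addnA.
Qed.

Lemma le_heads_prob r i j : (i <= j)%N -> p i r <= p j r.
Proof.
move=> ij; apply: ler_prod => k _; rewrite subr_ge0 ltW ?q_lt1//=.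
by rewrite lerD2l lerN2 q_noninc// ltnS leq_add2r.
Qed.

Lemma heads_prob_le_expR i r n : (i + r <= n)%N ->
  p i r <= expR (- (r%:R * q n)).
Proof.
move=> irn; rewrite -mulrN expRM_natl -[in leRHS](card_ord r) -prodr_const.
apply: ler_prod => k _; rewrite subr_ge0 ltW ?q_lt1//=.
apply: le_trans (expR_ge1Dx _); rewrite lerD2l lerN2 q_noninc//.
by have := ltn_ord k; lia.
Qed.

Lemma heads_prob_ge_expR i r h : (0 < h)%N -> (h <= i.+1)%N ->
  expR (- (r%:R * (q h / (1 - q h)))) <= p i r.
Proof.
move=> h0 hi; rewrite -mulrN expRM_natl -[in leLHS](card_ord r) -prodr_const.
apply: ler_prod => k _.
rewrite expR_ge0 (le_trans (expR_frac_le1B (q_lt1 h0)))//.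
by rewrite lerD2l lerN2 q_noninc//; lia.
Qed.

Lemma mean_runs_ge0 r n : 0 <= mean_runs q r n.
Proof. by apply: sumr_ge0 => i _; rewrite mulr_ge0. Qed.

(* Chebyshev's sum inequality: [p i r] increases with [i]. *)
Lemma mean_runs_head h r n : (h <= n.+1 - r)%N ->
  (\sum_(0 <= i < h) q i * p i r) * S (n.+1 - r) <= S h * mean_runs q r n.
Proof.
move=> hn; rewrite /partial_sum /mean_runs.
rewrite !(big_cat_nat (n := h) (m := 0) (p := (n.+1 - r)%N))//=.
set A := \sum_(0 <= _ < h) (_ * _); set a := \sum_(0 <= _ < h) q _.
set B := \sum_(h <= _ < _) (_ * _); set b := \sum_(h <= _ < _) q _.
have a0 : 0 <= a by apply: sumr_ge0.
have b0 : 0 <= b by apply: sumr_ge0.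
rewrite !mulrDr [a * A]mulrC lerD2l.
apply: (@le_trans _ _ (a * p h r * b)).
  rewrite ler_wpM2r// mulr_suml; apply: ler_sum_nat => i /andP[_ ih].
  by rewrite ler_wpM2l// le_heads_prob// ltnW.
rewrite -mulrA ler_wpM2l// mulrC mulr_suml; apply: ler_sum_nat => i /andP[hi _].
by rewrite ler_wpM2l// le_heads_prob.
Qed.

(** The [s] additional tosses have index at most [n], hence head probability at most [1 - q n]; a
    shorter run moreover has more possible starts. *)
Lemma mean_runsD_le r s n :
  mean_runs q (r + s) n <= expR (- (s%:R * q n)) * mean_runs q r n.
Proof.
rewrite /mean_runs mulr_sumr.
apply: (@le_trans _ _ (\sum_(0 <= i < n.+1 - (r + s))
    expR (- (s%:R * q n)) * (q i * p i r))).
  apply: ler_sum_nat => i /andP[_ ih]; rewrite heads_probD mulrA mulrC.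
  by rewrite ler_wpM2r ?mulr_ge0// heads_prob_le_expR//; lia.
rewrite [leRHS](big_cat_nat (n := (n.+1 - (r + s))%N))//=; last by lia.
by rewrite lerDl; apply: sumr_ge0 => i _; rewrite !mulr_ge0 ?expR_ge0.
Qed.

(* Shifting the index by [s], the term of [mean_runs q (r + s) n] at [i] is
   compared with the term of [mean_runs q r n] at [i + s]. *)
Lemma mean_runsD_ge h r s n : (0 < h)%N -> (h + s <= n.+1 - r)%N ->
  expR (- (s%:R * (q h / (1 - q h)))) *
    (1 - S (h + s) / S (n.+1 - r)) * mean_runs q r n <= mean_runs q (r + s) n.
Proof.
move=> h0 hsn; set e := expR _.
have e0 : 0 <= e by apply: expR_ge0.
have S0 : 0 < S (n.+1 - r).
  have [k ->] : exists k, (n.+1 - r)%N = k.+1 by exists (n.+1 - r).-1; lia.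
  by rewrite /partial_sum big_nat_recl//= ltr_wpDr// sumr_ge0.
(* Starts below [h + s] carry at most the fraction [S (h + s) / S (n.+1 - r)] of the sum. Only the
   other starts are kept; after the shift by [s] they begin at [h]. *)
have head := mean_runs_head hsn.
rewrite -mulrA; apply: (@le_trans _ _ (e *
    \sum_(h + s <= i < n.+1 - r) q i * p i r)).
  rewrite ler_wpM2l// mulrBl mul1r lerBlDr.
  rewrite [leLHS](big_cat_nat (n := (h + s)%N))//= addrC lerD2l.
  by rewrite mulrAC ler_pdivlMr.
rewrite -(subnK (_ : s <= n.+1 - r)%N); last by lia.
rewrite big_addn addnK -subnDA /mean_runs mulr_sumr.
rewrite [leRHS](big_cat_nat (n := h))//=; last by lia.
apply: ler_wpDl; first by apply: sumr_ge0 => i _; rewrite mulr_ge0.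
apply: ler_sum_nat => i /andP[hi _]; rewrite [(r + s)%N]addnC heads_probD.
rewrite mulrCA; apply: ler_pM; rewrite ?mulr_ge0 ?q_noninc ?leq_addr//.
by rewrite ler_wpM2r// heads_prob_ge_expR// leqW.
Qed.

(** This is [mean_runsD_le] started from length 0, where each head probability is an empty
    product. *)
Lemma mean_runs_le r n : mean_runs q r n <= S n.+1 * expR (- (r%:R * q n)).
Proof.
have := mean_runsD_le 0 r n; rewrite add0n => /le_trans; apply.
rewrite mulrC ler_wpM2r ?expR_ge0// /mean_runs subn0 ler_sum// => i _.
by rewrite /heads_prob big_ord0 mulr1.
Qed.

Lemma mean_runs_ge h r n : (0 < h)%N -> (h <= n.+1 - r)%N ->
  (S (n.+1 - r) - S h) * expR (- (r%:R * (q h / (1 - q h)))) <= mean_runs q r n.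
Proof.
move=> h0 hn; rewrite /partial_sum /mean_runs.
rewrite !(big_cat_nat (n := h) (m := 0) (p := (n.+1 - r)%N))//=.
rewrite addrAC subrr add0r; apply: ler_wpDl.
  by apply: sumr_ge0 => i _; rewrite mulr_ge0.
rewrite mulr_suml; apply: ler_sum_nat => i /andP[hi _]; rewrite ler_wpM2l//.
by apply: heads_prob_ge_expR => //; exact: leqW.
Qed.

(** Reindexing from the end [k.+1] of a run to its start. [G] is kept general so that it may later
    be cut off at [h]. *)
Let sum_run_end (G : nat -> R) r n : (0 < r)%N ->
  \sum_(0 <= k < n) (if (r <= k.+1)%N then G (k.+1 - r)%N else 0) =
  \sum_(0 <= i < n.+1 - r) G i.
Proof.
case: r => // r _; rewrite subSS.
under eq_bigr do rewrite ltnS subSS.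
have [rn|nr] := leqP r n; last first.
  have -> : (n - r = 0)%N by lia.
  rewrite [RHS]big_geq// big_nat big1// => k /andP[_ kn]; case: ifP => //; lia.
rewrite (big_cat_nat (n := r))//= big_nat big1 ?add0r; last first.
  by move=> k /andP[_ kr]; case: ifP => //; lia.
rewrite -{1}[r]add0n big_addn; apply: eq_big_nat => k _.
by rewrite leq_addl addnK.
Qed.

Lemma sum_run_end_prob r n : (0 < r)%N ->
  \sum_(k < n) run_end_prob q r k.+1 = mean_runs q r n.
Proof.
move=> r0; rewrite -(big_mkord xpredT (fun k => run_end_prob q r k.+1)).
exact: (sum_run_end (fun i => q i * p i r)).
Qed.

Lemma run_end_prob_ge0 r k : 0 <= run_end_prob q r k.
Proof. by rewrite /run_end_prob; case: ifP => // _; rewrite mulr_ge0. Qed.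

(** Runs starting below [h] are bounded by their total over all ends. Each remaining term is at most
    [q h * expR (- (r%:R * q n))], and the window has at most [r.+1] terms. *)
Lemma run_end_prob_window h r n m :
  (0 < r)%N -> (h <= n.+1 - r)%N -> (m < n)%N ->
  \sum_(m - r <= k < m.+1) run_end_prob q r k.+1 <=
  \sum_(0 <= i < h) q i * p i r + r.+1%:R * (q h * expR (- (r%:R * q n))).
Proof.
move=> r0 hn mn; set M := q h * _.
have M0 : 0 <= M by rewrite mulr_ge0 ?expR_ge0.
pose G i := if (i < h)%N then q i * p i r else 0.
have G0 i : 0 <= G i by rewrite /G; case: ifP => // _; rewrite mulr_ge0.
pose g k := if (r <= k.+1)%N then G (k.+1 - r)%N else 0.
have g0 k : 0 <= g k by rewrite /g; case: ifP.
apply: (@le_trans _ _ (\sum_(m - r <= k < m.+1) (g k + M))).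
  apply: ler_sum_nat => k /andP[_ km]; rewrite /g /run_end_prob.
  case: ifP => rk; last by rewrite add0r.
  rewrite /G; case: ltnP => hk; first by rewrite lerDl.
  rewrite add0r ler_pM//; first exact: q_noninc.
  by apply: heads_prob_le_expR; lia.
rewrite big_split /= sumr_const_nat -[X in _ + X]mulr_natl lerD//; last first.
  by rewrite ler_wpM2r// ler_nat; lia.
apply: (@le_trans _ _ (\sum_(0 <= k < n) g k)).
  rewrite (big_cat_nat (n := (m - r)%N) (m := 0%N))//=; last by lia.
  rewrite [X in _ <= _ + X](big_cat_nat (n := m.+1))//=; last by lia.
  rewrite addrCA lerDl addr_ge0//; exact: sumr_ge0.
rewrite sum_run_end// (big_cat_nat (n := h))//=.
rewrite [X in _ + X](_ : _ = 0) ?addr0.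
  by apply: ler_sum_nat => i /andP[_ ih]; rewrite /G ih.
by rewrite big_nat big1// => i /andP[hi _]; rewrite /G ltnNge hi.
Qed.
End MeanRuns.

(** * Slow variation *)

Lemma cvgy_mul_expRN (R : realType) (u : nat -> R) :
  u n @[n --> \oo] --> +oo -> u n * expR (- u n) @[n --> \oo] --> (0 : R).
Proof.
move=> uy; apply/cvgrPdist_lt => e e0.
(* The threshold is matched to [expR u >= 1 + u ^+ 2 / 2]: beyond it [e * u ^+ 2 / 2 >= u]. *)
have uA := (cvgryPge _).1 uy (2 / e).
near=> n; have un : 2 / e <= u n by near: n; exact: uA.
have u0 : 0 < u n by apply: lt_le_trans un; rewrite divr_gt0.
rewrite sub0r normrN ger0_norm ?mulr_ge0 ?expR_ge0 ?ltW//.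
rewrite expRN ltr_pdivrMr ?expR_gt0//.
have /(expR_ge1Dxn 1) := ltW u0; rewrite (_ : 2`!%:R = 2)// => ex.
have : 2 <= e * u n by rewrite mulrC -ler_pdivrMr.
have : 0 < 1 * e by rewrite mul1r.
nra.
Unshelve. all: by end_near. Qed.

Lemma cvgy_ln (R : realType) (u : nat -> R) :
  u n @[n --> \oo] --> +oo -> ln (u n) @[n --> \oo] --> +oo.
Proof.
move=> uy; apply/cvgryPge => A.
have uA := (cvgryPge _).1 uy (expR A).
near=> n; have un : expR A <= u n by near: n; exact: uA.
rewrite -ler_expR lnK// posrE; apply: lt_le_trans un; exact: expR_gt0.
Unshelve. all: by end_near. Qed.

Lemma cvgy_ln_div (R : realType) (u : nat -> R) :
  u n @[n --> \oo] --> +oo -> ln (u n) / u n @[n --> \oo] --> (0 : R).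
Proof.
move=> uy; have uA := (cvgryPge _).1 uy 1.
apply: cvg_trans (cvgy_mul_expRN (cvgy_ln uy)); apply: near_eq_cvg.
near=> n; have un : 1 <= u n by near: n; exact: uA.
by rewrite expRN lnK// posrE; apply: lt_le_trans un.
Unshelve. all: by end_near. Qed.

(** [m n] is the largest [M < n] for which [A M] holds from [n] on. Every fixed [M] eventually
    qualifies, so [m] tends to infinity; once 0 qualifies, the maximum is attained by a qualifying
    index. *)
Lemma diagonal_sequence (A : nat -> nat -> Prop) :
  (forall M, \forall n \near \oo, A M n) ->
  exists m : nat -> nat, (forall M, \forall n \near \oo, (M <= m n)%N) /\
    \forall n \near \oo, A (m n) n.
Proof.
move=> hA; pose B M n := `[< forall k, (n <= k)%N -> A M k >].
have hB M : \forall n \near \oo, B M n.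
  have [N _ hN] := hA M; exists N => // n /= Nn; apply/asboolP => k nk.
  by apply: hN; exact: leq_trans nk.
pose m n := \max_(M < n | B M n) M; exists m; split=> [M|].
  near=> n; have Mn : (M < n)%N by near: n; exact: nbhs_infty_gt.
  have BMn : B M n by near: n; exact: hB.
  exact: (@leq_bigmax_cond _ _ (fun M : 'I_n => nat_of_ord M) (Ordinal Mn)).
near=> n; have n0 : (0 < n)%N by near: n; exact: nbhs_infty_gt.
have B0 : B 0%N n by near: n; exact: hB.
rewrite /m (bigop.bigmax_eq_arg (Ordinal n0))//.
by case: arg_maxnP => //= M /asboolP + _; apply.
Unshelve. all: by end_near. Qed.

Section Karamata.
Variables (R : realType) (q : nat -> R).
Hypothesis q_gt0 : forall k, 0 < q k.
Hypothesis q_noninc : forall m n, (m <= n)%N -> q n <= q m.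
Hypothesis q_slow : forall M, (0 < M)%N ->
  q (n %/ M)%N / q n @[n --> \oo] --> (1 : R).

Local Notation S := (partial_sum q).

Let q_ge0 k : 0 <= q k. Proof. exact: ltW. Qed.

Lemma partial_sum_nondec m n : (m <= n)%N -> S m <= S n.
Proof.
move=> mn; rewrite /partial_sum [leRHS](big_cat_nat (n := m))//= lerDl.
exact: sumr_ge0.
Qed.

Lemma partial_sum_gt0 n : (0 < n)%N -> 0 < S n.
Proof.
case: n => // n _; rewrite /partial_sum big_nat_recl//= ltr_wpDr//.
exact: sumr_ge0.
Qed.

Lemma partial_sumB_le m n : (m <= n)%N -> S n - S m <= (n - m)%:R * q m.
Proof.
move=> mn; rewrite /partial_sum (big_cat_nat (n := m) (p := n))//= addrAC subrr.
rewrite add0r mulr_natl -sumr_const_nat; apply: ler_sum_nat => i /andP[mi _].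
exact: q_noninc.
Qed.

Lemma partial_sum_ge n : n%:R * q n <= S n.
Proof.
rewrite mulr_natl -[X in _ *+ X]subn0 -sumr_const_nat; apply: ler_sum_nat.
by move=> i /andP[_ /ltnW]; exact: q_noninc.
Qed.

Lemma slow_near M (K : R) : (0 < M)%N -> 1 < K ->
  \forall n \near \oo, q (n %/ M)%N <= K * q n.
Proof.
move=> M0 K1; have := cvgr_le _ (q_slow M0) _ K1.
by move=> h; near=> n; rewrite -ler_pdivrMr//; near: n; exact: h.
Unshelve. all: by end_near.
Qed.

(* Halving: [S n <= S h + (n - h) q h] with [h = n / 2]. *)
Lemma partial_sum_le (e : R) : 0 < e -> e < 1 ->
  exists C, forall n, S n <= (1 + e) / (1 - e) * (n%:R * q n) + C.
Proof.
move=> e0 e1; set K := _ / _.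
have KE : K * (1 - e) = 1 + e by rewrite divfK// subr_eq0 eq_sym lt_eqF.
have e1' : 1 < 1 + e by rewrite ltrDl.
have [N _ hN] := slow_near (isT : (0 < 2)%N) e1'.
have K0 : 0 <= K by rewrite divr_ge0// ?subr_ge0 ?addr_ge0// ltW.
exists (S N.+1); elim/ltn_ind => n IH.
have [nN|Nn] := leqP n N.+1.
  apply: (le_trans (partial_sum_nondec nN)).
  by rewrite lerDr mulr_ge0// mulr_ge0.
have {hN} := hN n (ltnW (ltnW Nn)).
set h := (n %/ 2)%N => /= qh.
have hn : (h < n)%N by rewrite ltn_Pdiv//; lia.
have {IH} := IH h hn.
have := partial_sumB_le (ltnW hn).
have [b [bE nE]] : exists b, (n - h = h + b)%N /\ (n = 2 * h + b)%N.
  by exists (n - 2 * h)%N; lia.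
rewrite bE (_ : n%:R = 2 * h%:R + b%:R :> R); last first.
  by rewrite [in LHS]nE natrD natrM.
rewrite natrD => S1 S2.
set x := h%:R : R in S1 S2 *; set y := b%:R : R in S1 S2 *.
have x0 : 0 <= x by []. have y0 : 0 <= y by [].
have z0 : 0 <= (K + 1) * x + y by rewrite addr_ge0// mulr_ge0// addr_ge0.
have := ler_wpM2l z0 qh => S3.
suff : ((K + 1) * x + y) * (1 + e) <= K * (2 * x + y).
  move=> /(ler_wpM2r (q_ge0 n)) S4.
  have S5 : S n <= ((K + 1) * x + y) * q h + S N.+1 by clearbody K x y h; lra.
  apply: (le_trans S5); rewrite lerD2r (le_trans S3)//.
  by rewrite [leLHS]mulrA [leRHS]mulrA.
have : 1 + e <= K by rewrite -KE ler_piMr//; lra.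
nra.
Qed.

(** It suffices to bound [n%:R * q n], which lies below [S n], along a sequence of doublings. *)
Lemma partial_sum_cvgy : S n @[n --> \oo] --> +oo.
Proof.
(* With this constant each doubling multiplies [n%:R * q n] by at least [2 / (4 / 3) = 3 / 2]; the
   linear growth [1 + k / 2] is then enough. *)
have K1 : 1 < 4 / 3 :> R by lra.
have [N _ hN] := slow_near (isT : (0 < 2)%N) K1.
pose v n := n%:R * q n.
have v_double k : (1 + k%:R / 2) * v N.+1 <= v (2 ^ k * N.+1)%N.
  elim: k => [|k IH]; first by rewrite mul0r addr0 mul1r mul1n.
  have := hN (2 ^ k.+1 * N.+1)%N; rewrite /= expnS -mulnA mulKn//.
  set m := (2 ^ k * N.+1)%N in IH *.
  have mN : (N.+1 <= m)%N by rewrite leq_pmull// expn_gt0.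
  move=> /(_ ltac:(lia)) qm; apply: (@le_trans _ _ (3 / 2 * v m)); last first.
    rewrite /v natrM; have := ler_wpM2l (ler0n R m) qm; nra.
  have v0 : 0 <= v N.+1 by rewrite mulr_ge0.
  have k0 : 0 <= k%:R :> R by [].
  rewrite -natr1; have := mulr_ge0 k0 v0; nra.
apply/cvgryPge => A.
have v0 : 0 < v N.+1 by rewrite mulr_gt0.
pose k := (Num.truncn (2 * A / v N.+1)).+1.
have kA : A <= (1 + k%:R / 2) * v N.+1.
  have := truncnS_gt (2 * A / v N.+1); rewrite ltr_pdivrMr// -/k; nra.
exists (2 ^ k * N.+1)%N => // n /= /partial_sum_nondec; apply: le_trans.
by rewrite (le_trans kA)// (le_trans (v_double k))// partial_sum_ge.
Qed.

(** The ratio is at most 1 by [partial_sum_ge]. The lower bound is [partial_sum_le], its additive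
    constant being absorbed by the divergence of [S]. *)
Lemma karamata : n%:R * q n / S n @[n --> \oo] --> (1 : R).
Proof.
apply/cvgrPdist_lt => e e0.
(* The factor [(1 - e') / (1 + e')] loses at most [2 * e' <= e / 2]; the other [e / 2] pays for the
   constant [C]. *)
pose e' := Num.min (e / 4) (1 / 2).
have e'0 : 0 < e' by rewrite lt_min !divr_gt0.
have e'e : e' <= e / 4 by rewrite ge_min lexx.
have e'1 : e' <= 1 / 2 by rewrite ge_min lexx orbT.
have [C hC] := partial_sum_le e'0 (ltac:(lra) : e' < 1).
have SC := (cvgryPge _).1 partial_sum_cvgy (2 * `|C| / e).
near=> n.
have Sn0 : 0 < S n by apply: partial_sum_gt0; near: n; exact: nbhs_infty_gt.
have Ce : 2 * `|C| <= S n * e by rewrite -ler_pdivrMr//; near: n; exact: SC.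
rewrite ger0_norm ?subr_ge0 ?ler_pdivrMr ?mul1r ?partial_sum_ge//.
rewrite ltrBlDr -ltrBlDl ltr_pdivlMr//.
have e'1' : 0 < 1 - e' by lra.
have S1 : S n * (1 - e') <= (1 + e') * (n%:R * q n) + `|C|.
  have := hC n; rewrite mulrAC -lerBlDr ler_pdivlMr// mulrBl => S1.
  have : C * (1 - e') <= `|C| * (1 - e') by rewrite ler_wpM2r ?ler_norm// ltW.
  have : `|C| * (1 - e') <= `|C| by rewrite ler_piMr//; lra.
  move: S1; set v := _ * q n; lra.
rewrite -(ltr_pM2l (ltac:(lra) : 0 < 1 + e')).
have S2 : S n * (2 * e') <= S n * (e / 2).
  by rewrite ler_wpM2l ?(ltW Sn0)//; lra.
have : 0 < S n * (e * e') by rewrite !mulr_gt0.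
move: S1; set v := _ * q n; lra.
Unshelve. all: by end_near. Qed.
End Karamata.

Lemma cvg_natV0 (R : realType) (m : nat -> nat) :
  (forall M, \forall n \near \oo, (M <= m n)%N) ->
  (m n)%:R^-1 @[n --> \oo] --> (0 : R).
Proof.
move=> my; apply/cvgrPdist_lt => e e0; near=> n.
have mn : ((Num.truncn e^-1).+1 <= m n)%N by near: n; exact: my.
have em : e^-1 < (m n)%:R.
  by rewrite (lt_le_trans (truncnS_gt e^-1))// ler_nat.
have m0 : 0 < (m n)%:R :> R by rewrite (lt_trans _ em)// invr_gt0.
rewrite sub0r normrN ger0_norm ?invr_ge0 ?ltW//.
by rewrite -[e]invrK ltf_pV2 ?posrE ?invr_gt0.
Unshelve. all: by end_near. Qed.

Section SlowScale.
Variables (R : realType) (q : nat -> R).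
Hypothesis q_gt0 : forall k, 0 < q k.
Hypothesis q_noninc : forall m n, (m <= n)%N -> q n <= q m.
Hypothesis q_slow : forall M, (0 < M)%N ->
  q (n %/ M)%N / q n @[n --> \oo] --> (1 : R).

Local Notation S := (partial_sum q).

Lemma partial_sum_le_near : \forall n \near \oo, S n <= 2 * (n%:R * q n).
Proof.
have h := cvgr_ge _ (karamata q_gt0 q_noninc q_slow) (1 / 2) ltac:(lra).
near=> n; have Sn0 : 0 < S n.
  by apply: partial_sum_gt0 => //; near: n; exact: nbhs_infty_gt.
have : 1 / 2 <= n%:R * q n / S n by near: n; exact: h.
rewrite ler_pdivlMr//; lra.
Unshelve. all: by end_near. Qed.

(* [h n = n %/ m n] for an [m] tending slowly enough to infinity. *)
Lemma slow_scale : exists h : nat -> nat,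
  [/\ \forall n \near \oo, (0 < h n)%N, \forall n \near \oo, (4 * h n <= n)%N,
      q (h n) / q n @[n --> \oo] --> (1 : R) &
      S (h n) / S n @[n --> \oo] --> (0 : R)].
Proof.
have [M|m [my Am]] := @diagonal_sequence (fun M n => (0 < M)%N ->
    [/\ (0 < n %/ M)%N, q (n %/ M)%N <= (1 + M%:R^-1) * q n &
        S (n %/ M)%N <= 4 * M%:R^-1 * S n]) _.
  have [->|M0] := posnP M; first by near=> n.
  have M0' : 0 < M%:R^-1 :> R by rewrite invr_gt0 ltr0n.
  have K1 : 1 < 1 + M%:R^-1 :> R by rewrite ltrDl.
  have h1 := slow_near q_gt0 q_slow M0 K1.
  have h2 := slow_near q_gt0 q_slow M0 (ltr1n R 2 : 1 < 2).
  have h3 := cvg_divnr M M0 _ partial_sum_le_near.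
  near=> n => _; split.
  - by rewrite divn_gt0//; near: n; exact: nbhs_infty_ge.
  - by near: n; exact: h1.
  (* The 4 in the bound is one factor 2 from [partial_sum_le_near] and another from
     [q (n %/ M) <= 2 * q n]. *)
  - have S1 : S (n %/ M)%N <= 2 * ((n %/ M)%N%:R * q (n %/ M)%N).
      by near: n; exact: h3.
    have S2 : q (n %/ M)%N <= 2 * q n by near: n; exact: h2.
    apply: (le_trans S1).
    have S3 : (n %/ M)%N%:R <= M%:R^-1 * n%:R :> R.
      by rewrite ler_pdivlMl ?ltr0n// -natrM ler_nat mulnC leq_trunc_div.
    have S4 : (n %/ M)%N%:R * q (n %/ M)%N <= M%:R^-1 * n%:R * (2 * q n).
      by rewrite ler_pM// ltW.
    have := ler_wpM2l (ltW M0') (partial_sum_ge q_noninc n).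
    lra.
have m0 := @cvg_natV0 R _ my.
have {}Am : \forall n \near \oo, [/\ (0 < n %/ m n)%N,
    q (n %/ m n)%N <= (1 + (m n)%:R^-1) * q n &
    S (n %/ m n)%N <= 4 * (m n)%:R^-1 * S n].
  near=> n; have mn : (0 < m n)%N by near: n; exact: my.
  by move: mn; near: n; exact: Am.
exists (fun n => n %/ m n)%N.
split.
- by apply: filterS Am => n [].
- near=> n; have mn : (4 <= m n)%N by near: n; exact: my.
  by rewrite (leq_trans _ (leq_trunc_div n (m n)))// mulnC leq_mul.
- apply: (@squeeze_cvgr _ _ _ _ (fun=> 1) (fun n => 1 + (m n)%:R^-1)).
  + apply: filterS Am => n [_ qm _].
    rewrite /=; apply/andP; split; last by rewrite ler_pdivrMr.
    by rewrite ler_pdivlMr// mul1r q_noninc// leq_div.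
  + exact: cvg_cst.
  + by rewrite -[X in _ --> X]addr0; apply: cvgD => //; exact: cvg_cst.
- apply: (@squeeze_cvgr _ _ _ _ (fun=> 0) (fun n => 4 * (m n)%:R^-1)).
  + apply: filterS Am => n [hn _ Sm] /=.
    have Sn0 : 0 < S n.
      by apply: partial_sum_gt0 => //; apply: leq_trans hn (leq_div _ _).
    apply/andP; split; last by rewrite ler_pdivrMr.
    by rewrite divr_ge0// ltW// partial_sum_gt0.
  + exact: cvg_cst.
  + by rewrite -[X in _ --> X](mulr0 4); apply: cvgM => //; exact: cvg_cst.
Unshelve. all: by end_near. Qed.
End SlowScale.

(** * Asymptotics at the critical run length *)

Lemma near_eq_cvgn (R : realType) (f g : nat -> R) (a b : R) :
  f n @[n --> \oo] --> a -> a = b -> (\forall n \near \oo, f n = g n) ->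
  g n @[n --> \oo] --> b.
Proof. by move=> fa <- fg; apply: cvg_trans fa; exact: near_eq_cvg. Qed.

Lemma cvgnM (R : realType) (f g : nat -> R) (a b : R) :
  f n @[n --> \oo] --> a -> g n @[n --> \oo] --> b ->
  f n * g n @[n --> \oo] --> a * b.
Proof. exact: cvgM. Qed.

Lemma cvgnD (R : realType) (f g : nat -> R) (a b : R) :
  f n @[n --> \oo] --> a -> g n @[n --> \oo] --> b ->
  f n + g n @[n --> \oo] --> a + b.
Proof. exact: cvgD. Qed.

Lemma cvgnB (R : realType) (f g : nat -> R) (a b : R) :
  f n @[n --> \oo] --> a -> g n @[n --> \oo] --> b ->
  f n - g n @[n --> \oo] --> a - b.
Proof. exact: cvgB. Qed.

Lemma cvgnV (R : realType) (f : nat -> R) (a : R) : a != 0 ->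
  f n @[n --> \oo] --> a -> (f n)^-1 @[n --> \oo] --> a^-1.
Proof. exact: cvgV. Qed.

Lemma cvgn_expRN (R : realType) (f : nat -> R) (a : R) :
  f n @[n --> \oo] --> a -> expR (- f n) @[n --> \oo] --> expR (- a).
Proof.
by move=> fa; apply: continuous_cvg; [exact: continuous_expR|exact: cvgN].
Qed.

(** The factor 2 leaves room above the critical length, while [r n] stays negligible against [n] by
    Karamata's theorem. *)
Definition short (R : realType) (q : nat -> R) (r : nat -> nat) : Prop :=
  \forall n \near \oo, (r n)%:R * q n <= 2 * ln (partial_sum q n).

(** The scale on which [partial_sum q n * expR (- ((r n)%:R * q n))] can be of order 1. *)
Definition critical (R : realType) (q : nat -> R) (r : nat -> nat) : Prop :=
  (r n)%:R * q n / ln (partial_sum q n) @[n --> \oo] --> (1 : R).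

Section LongRuns.
Variables (R : realType) (q : nat -> R) (h : nat -> nat).
Hypothesis q_gt0 : forall k, 0 < q k.
Hypothesis q_lt1 : forall k, (0 < k)%N -> q k < 1.
Hypothesis q_noninc : forall m n, (m <= n)%N -> q n <= q m.
Hypothesis q_slow : forall M, (0 < M)%N ->
  q (n %/ M)%N / q n @[n --> \oo] --> (1 : R).
Hypothesis q_cvg0 : q n @[n --> \oo] --> (0 : R).
Hypothesis h_gt0 : \forall n \near \oo, (0 < h n)%N.
Hypothesis h_le : \forall n \near \oo, (4 * h n <= n)%N.
Hypothesis q_h : q (h n) / q n @[n --> \oo] --> (1 : R).
Hypothesis S_h : partial_sum q (h n) / partial_sum q n @[n --> \oo] --> (0 : R).

Local Notation S := (partial_sum q).
Local Notation L := (mean_runs q).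

Let q_ge0 k : 0 <= q k. Proof. exact: ltW. Qed.

Let S_cvgy : S n @[n --> \oo] --> +oo.
Proof. exact: (partial_sum_cvgy q_gt0 q_noninc q_slow). Qed.

Let S_gt0 : \forall n \near \oo, 0 < S n.
Proof. by exists 1%N => // n /=; exact: (partial_sum_gt0 q_gt0). Qed.

Let lnS_cvgy : ln (S n) @[n --> \oo] --> +oo.
Proof. exact: cvgy_ln. Qed.

Let lnS_gt0 : \forall n \near \oo, 0 < ln (S n).
Proof. by move/cvgryPgt: lnS_cvgy => /(_ 0). Qed.

Let lnSV : (ln (S n))^-1 @[n --> \oo] --> (0 : R).
Proof. by apply/gtr0_cvgV0. Qed.

Let lnS_div : ln (S n) / S n @[n --> \oo] --> (0 : R).
Proof. exact: cvgy_ln_div. Qed.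

Let q_h_cvg0 : q (h n) @[n --> \oo] --> (0 : R).
Proof.
refine (near_eq_cvgn (cvgnM q_h q_cvg0) (mul1r _) _).
by near=> n; rewrite divfK// gt_eqF.
Unshelve. all: by end_near. Qed.

(** The exponent per toss in [heads_prob_ge_expR], valid for runs starting at [h n] or later. *)
Let odds n := q (h n) / (1 - q (h n)).

Let odds_cvg : odds n / q n @[n --> \oo] --> (1 : R).
Proof.
have h1 : (1 - q (h n))^-1 @[n --> \oo] --> (1 : R).
  refine (near_eq_cvgn (cvgnV _ (cvgnB (cvg_cst (1 : R)) q_h_cvg0)) _ _).
  - by rewrite subr0 oner_neq0.
  - by rewrite subr0 invr1.
  - by near=> n.
refine (near_eq_cvgn (cvgnM q_h h1) (mulr1 _) _).
by near=> n; rewrite /= /odds mulrAC.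
Unshelve. all: by end_near. Qed.

Let scale_odds (u : nat -> R) (z : R) : u n * q n @[n --> \oo] --> z ->
  u n * odds n @[n --> \oo] --> z.
Proof.
move=> uz; refine (near_eq_cvgn (cvgnM uz odds_cvg) (mulr1 _) _).
by near=> n; rewrite -mulrA [q n * _]mulrC divfK// gt_eqF.
Unshelve. all: by end_near. Qed.

(** Eventually [r n * q n <= 2 * ln (S n) <= S n / 8 <= n * q n / 4]. *)
Let short_le r : short q r -> \forall n \near \oo, (4 * r n <= n)%N.
Proof.
move=> hr; have h1 := cvgr_le _ lnS_div (1 / 16) ltac:(lra).
have h2 := partial_sum_le_near q_gt0 q_noninc q_slow.
near=> n.
have Sn0 : 0 < S n by near: n.
have : ln (S n) / S n <= 1 / 16 by near: n; exact: h1.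
rewrite ler_pdivrMr// => lS.
have S2 : S n <= 2 * (n%:R * q n) by near: n; exact: h2.
have rq : (r n)%:R * q n <= 2 * ln (S n) by near: n; exact: hr.
have : 4 * (r n)%:R * q n <= n%:R * q n by lra.
by rewrite ler_pM2r// -natrM ler_nat.
Unshelve. all: by end_near. Qed.

(** Fewer than [r n] terms are missing, all of index at least [h n] and so at most [2 * q n]; their
    sum is at most [4 * ln (S n) <= S n / 4]. *)
Let short_partial_sum r : short q r ->
  \forall n \near \oo, S n / 2 <= S (n.+1 - r n).
Proof.
move=> hr; have h1 := cvgr_le _ lnS_div (1 / 16) ltac:(lra).
have h2 := cvgr_le _ q_h 2 ltac:(lra).
have h3 := short_le hr.
near=> n.
have Sn0 : 0 < S n by near: n.
have [r0|r0] := posnP (r n).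
  by rewrite r0 subn0 (le_trans _ (partial_sum_nondec q_gt0 (leqnSn n)))//; lra.
have : ln (S n) / S n <= 1 / 16 by near: n; exact: h1.
rewrite ler_pdivrMr// => lS.
have : q (h n) / q n <= 2 by near: n; exact: h2.
rewrite ler_pdivrMr// => qh.
have rn : (4 * r n <= n)%N by near: n; exact: h3.
have hn : (4 * h n <= n)%N by near: n.
have rq : (r n)%:R * q n <= 2 * ln (S n) by near: n; exact: hr.
have := partial_sumB_le q_noninc (ltac:(lia) : (n.+1 - r n <= n)%N).
have S1 : (n - (n.+1 - r n))%:R * q (n.+1 - r n) <= (r n)%:R * (2 * q n).
  apply: ler_pM => //; first by rewrite ler_nat; lia.
  by apply: le_trans qh; apply: q_noninc; lia.
lra.
Unshelve. all: by end_near. Qed.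

Lemma mean_runs_gt0 r n : (r <= n)%N -> 0 < L r n.
Proof.
move=> rn; rewrite /mean_runs subSn// big_nat_recl//= ltr_wpDr//.
  by apply: sumr_ge0 => i _; rewrite mulr_ge0 ?ltW ?heads_prob_gt0.
by rewrite mulr_gt0 ?heads_prob_gt0.
Qed.

(** The ratio is squeezed between the bounds of [mean_runsD_ge] and [mean_runsD_le]. The discarded
    fraction is at most [2 * (S (h n) + s n * q (h n)) / S n], which vanishes in the limit. *)
Lemma mean_runsD_ratio r s z : short q r -> (s n)%:R * q n @[n --> \oo] --> z ->
  L (r n + s n) n / L (r n) n @[n --> \oo] --> expR (- z).
Proof.
move=> hr sz.
have hs : short q s.
  have h1 := cvgr_le _ sz (z + 1) ltac:(by rewrite ltrDl).
  have h2 := (cvgryPge _).1 lnS_cvgy ((z + 1) / 2).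
  near=> n; apply: (@le_trans _ _ (z + 1)); first by near: n; exact: h1.
  by rewrite mulrC -ler_pdivrMr//; near: n; exact: h2.
pose lo n := expR (- ((s n)%:R * odds n)) *
  (1 - 2 * (S (h n) / S n + (s n)%:R * q (h n) / S n)).
apply: (@squeeze_cvgr _ _ _ _ lo (fun n => expR (- ((s n)%:R * q n)))).
- have h1 := short_le hr; have h2 := short_le hs.
  have h3 := short_partial_sum hr.
  near=> n.
  have rn : (4 * r n <= n)%N by near: n; exact: h1.
  have sn : (4 * s n <= n)%N by near: n; exact: h2.
  have hn : (4 * h n <= n)%N by near: n.
  have h0 : (0 < h n)%N by near: n.
  have Sn0 : 0 < S n by near: n.
  have Sr : S n / 2 <= S (n.+1 - r n) by near: n; exact: h3.
  have L0 : 0 < L (r n) n by apply: mean_runs_gt0; lia.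
  rewrite ler_pdivlMr// ler_pdivrMr//.
  apply/andP; split; last exact: mean_runsD_le.
  apply: le_trans (mean_runsD_ge q_gt0 q_lt1 q_noninc (r := r n) h0 _);
    last by lia.
  rewrite ler_wpM2r ?(ltW L0)// ler_wpM2l ?expR_ge0// lerD2l lerN2.
  rewrite ler_pdivrMr; last by apply: lt_le_trans Sr; rewrite divr_gt0.
  have S1 := partial_sumB_le q_noninc (leq_addr (s n) (h n)).
  rewrite addKn in S1.
  have a0 : 0 <= S (h n) / S n + (s n)%:R * q (h n) / S n.
    have Sh0 := ltW (partial_sum_gt0 q_gt0 h0).
    by rewrite addr_ge0// divr_ge0 ?mulr_ge0 ?(ltW Sn0).
  apply: le_trans (ler_wpM2l _ Sr); last by rewrite mulr_ge0.
  rewrite -mulrDl [leRHS](_ : _ = S (h n) + (s n)%:R * q (h n)); first by lra.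
  by field; rewrite gt_eqF.
- have S0 : (S n)^-1 @[n --> \oo] --> (0 : R) by apply/gtr0_cvgV0.
  have h1 : (s n)%:R * q (h n) / S n @[n --> \oo] --> (0 : R).
    refine (near_eq_cvgn (cvgnM (cvgnM sz q_h) S0) (mulr0 _) _).
    by near=> n; have Sn0 : 0 < S n; [near: n|field; rewrite !gt_eqF].
  have c2 : (2 : R) @[_ --> \oo] --> (2 : R) by exact: cvg_cst.
  have c1 : (1 : R) @[_ --> \oo] --> (1 : R) by exact: cvg_cst.
  refine (near_eq_cvgn (cvgnM (cvgn_expRN (scale_odds sz))
    (cvgnB c1 (cvgnM c2 (cvgnD S_h h1)))) _ _).
    by rewrite addr0 mulr0 subr0 mulr1.
  by near=> n.
- exact: cvgn_expRN.
Unshelve. all: by end_near. Qed.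

Let critical_short r : critical q r -> short q r.
Proof.
move=> hr; have h1 := cvgr_le _ hr 2 (ltr1n R 2).
near=> n; have lS : 0 < ln (S n) by near: n.
by rewrite -ler_pdivrMr//; near: n; exact: h1.
Unshelve. all: by end_near. Qed.

Let critical_cvgy r : critical q r -> (r n)%:R * q n @[n --> \oo] --> +oo.
Proof.
move=> hr; apply/cvgryPge => A; have h1 := cvgr_ge _ hr (1 / 2) ltac:(lra).
have h2 := (cvgryPge _).1 lnS_cvgy (2 * A).
near=> n; have lS : 0 < ln (S n) by near: n.
have : 1 / 2 <= (r n)%:R * q n / ln (S n) by near: n; exact: h1.
rewrite ler_pdivlMr// => h3.
have : 2 * A <= ln (S n) by near: n; exact: h2.
lra.
Unshelve. all: by end_near. Qed.

Let critical_gt0 r : critical q r -> \forall n \near \oo, (0 < r n)%N.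
Proof.
move=> hr; have h1 := (cvgryPgt _).1 (critical_cvgy hr) 0.
near=> n; have : 0 < (r n)%:R * q n by near: n; exact: h1.
by rewrite pmulr_lgt0// ltr0n.
Unshelve. all: by end_near. Qed.

(** The sandwich closes once the window sums vanish. At a critical length [r n * q n] diverges, so
    [r n * q n * expR (- (r n * q n))] tends to 0, and starts below [h n] are negligible by
    Chebyshev. *)
Lemma no_head_run_limit (Q : nat -> nat -> R) (r : nat -> nat) (lam : R) :
  (forall r n, 0 <= Q r n) ->
  (forall r, (0 < r)%N -> Q r 0%N = 1 /\
     forall n, Q r n.+1 = Q r n - run_end_prob q r n.+1 * Q r (n - r)%N) ->
  critical q r -> L (r n) n @[n --> \oo] --> lam ->
  Q (r n) n @[n --> \oo] --> expR (- lam).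
Proof.
move=> Q_ge0 Q_rec hr Llam.
(* The first 2 comes from [S n / 2 <= S (n.+1 - r n)], the second from [r.+1 <= 2 * r]. *)
pose s n := 2 * (S (h n) / S n) * L (r n) n +
  2 * ((r n)%:R * q n * expR (- ((r n)%:R * q n)) * (q (h n) / q n)).
have s0 : s n @[n --> \oo] --> (0 : R).
  have c2 : (2 : R) @[_ --> \oo] --> (2 : R) by exact: cvg_cst.
  have xe := cvgy_mul_expRN (critical_cvgy hr).
  refine (near_eq_cvgn (cvgnD (cvgnM (cvgnM c2 S_h) Llam)
    (cvgnM c2 (cvgnM xe q_h))) _ _).
    by rewrite !(mulr0, mul0r) addr0.
  by near=> n.
apply: (@squeeze_cvgr _ _ _ _ (fun n => expR (- L (r n) n) - s n * L (r n) n)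
  (fun n => expR (- L (r n) n))); last exact: cvgn_expRN.
- have h1 := short_le (critical_short hr).
  have h2 := short_partial_sum (critical_short hr).
  have h3 := critical_gt0 hr.
  near=> n.
  have r0 : (0 < r n)%N by near: n; exact: h3.
  have rn : (4 * r n <= n)%N by near: n; exact: h1.
  have hn : (4 * h n <= n)%N by near: n.
  have h0 : (0 < h n)%N by near: n.
  have Sn0 : 0 < S n by near: n.
  have Sr : S n / 2 <= S (n.+1 - r n) by near: n; exact: h2.
  have [Q0 QS] := Q_rec _ r0.
  have c0 := run_end_prob_ge0 q_gt0 q_lt1 (r n).
  have := recurrence_le_expR c0 Q0 QS (Q_ge0 (r n)) n.
  have := @recurrence_ge_expR _ _ _ _ c0 Q0 QS (Q_ge0 (r n)) (s n) n.
  rewrite sum_run_end_prob// => lb ->; rewrite andbT; apply: lb => m mn.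
  have hrn : (h n <= n.+1 - r n)%N by lia.
  apply: (le_trans (run_end_prob_window q_gt0 q_lt1 q_noninc r0 hrn mn)).
  rewrite /s; apply: lerD.
    have L0 : 0 <= L (r n) n by apply: mean_runs_ge0.
    have Sr0 : 0 < S (n.+1 - r n) by apply: lt_le_trans Sr; rewrite divr_gt0.
    have := mean_runs_head q_gt0 q_lt1 q_noninc hrn.
    rewrite -ler_pdivlMr// => /le_trans; apply.
    rewrite mulrAC ler_wpM2r// [2 * _]mulrCA ler_wpM2l//.
      exact: ltW (partial_sum_gt0 q_gt0 h0).
    rewrite -[leRHS]invrK invfM invrK lef_pV2 ?posrE ?mulr_gt0//.
    by rewrite mulrC.
  rewrite [leRHS](_ : _ = 2 * (r n)%:R * (q (h n) * expR (- ((r n)%:R * q n)))).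
    rewrite ler_wpM2r ?mulr_ge0 ?expR_ge0// -natrM ler_nat; lia.
  by field; rewrite gt_eqF.
- refine (near_eq_cvgn (cvgnB (cvgn_expRN Llam) (cvgnM s0 Llam)) _ _).
    by rewrite mul0r subr0.
  by near=> n.
Unshelve. all: by end_near. Qed.

Let q_lnS : q n / ln (S n) @[n --> \oo] --> (0 : R).
Proof. by refine (near_eq_cvgn (cvgnM q_cvg0 lnSV) (mulr0 _) _); near=> n.
Unshelve. all: by end_near. Qed.

(** * The run length at which the mean number of runs crosses 1 *)

Section Level.
Variable r : nat -> nat.
Hypothesis L_ge1 : forall n, 1 <= L (r n) n.
Hypothesis LS_lt1 : forall n, L (r n).+1 n < 1.

(** Take logarithms in [1 <= L (r n) n <= 2 * S n * expR (- (r n * q n))] and use [ln 2 <= 1]. *)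
Let level_le : \forall n \near \oo, (r n)%:R * q n <= ln (S n) + 1.
Proof.
near=> n.
have n0 : (0 < n)%N by near: n; exact: nbhs_infty_gt.
have Sn0 : 0 < S n by exact: partial_sum_gt0.
have S2 : S n.+1 <= 2 * S n.
  have := partial_sumB_le q_noninc (leqnSn n); rewrite subSnn mul1r.
  have : q n <= n%:R * q n by rewrite ler_peMl// ler1n.
  have := partial_sum_ge q_noninc n; lra.
have : expR ((r n)%:R * q n) <= 2 * S n.
  rewrite -[leLHS]mul1r -ler_pdivlMr ?expR_gt0// -expRN.
  apply: (le_trans (L_ge1 n)).
  apply: (le_trans (mean_runs_le q_gt0 q_lt1 q_noninc _ _)).
  by rewrite ler_wpM2r ?expR_ge0.
rewrite -ler_ln ?posrE ?expR_gt0 ?mulr_gt0// expRK lnM ?posrE// => /le_trans.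
apply; rewrite addrC lerD2l.
by have := @le_ln1Dx R 1 ltac:(lra); rewrite (_ : 1 + 1 = 2)//; lra.
Unshelve. all: by end_near. Qed.

Let level_short : short q (fun n => (r n).+1).
Proof.
have h2 := (cvgryPge _).1 lnS_cvgy 2.
near=> n.
have n0 : (0 < n)%N by near: n; exact: nbhs_infty_gt.
have : (r n)%:R * q n <= ln (S n) + 1 by near: n; exact: level_le.
have : 2 <= ln (S n) by near: n; exact: h2.
have := q_lt1 n0; rewrite -natr1; lra.
Unshelve. all: by end_near. Qed.

Let odds_gt0 : \forall n \near \oo, 0 < odds n.
Proof.
by near=> n; rewrite /odds divr_gt0// subr_gt0 q_lt1//; near: n.
Unshelve. all: by end_near. Qed.

(** Starts from [h n] on have total weight at least [S n / 2 - S n / 4], so [1 > L (r n).+1 n >= S n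
    / 4 * expR (- ((r n).+1 * odds n))]. The 3 is a crude bound for [ln 4]. *)
Let level_ge : \forall n \near \oo, ln (S n) - 3 <= (r n).+1%:R * odds n.
Proof.
have h1 := cvgr_le _ S_h (1 / 4) ltac:(lra).
have h2 := short_partial_sum level_short.
have h3 := short_le level_short.
near=> n.
have Sn0 : 0 < S n by near: n.
have rn : (4 * (r n).+1 <= n)%N by near: n; exact: h3.
have hn : (4 * h n <= n)%N by near: n.
have h0 : (0 < h n)%N by near: n.
have Sr : S n / 2 <= S (n.+1 - (r n).+1) by near: n; exact: h2.
have : S (h n) / S n <= 1 / 4 by near: n; exact: h1.
rewrite ler_pdivrMr// => Sh.
have hrn : (h n <= n.+1 - (r n).+1)%N by lia.
have := mean_runs_ge q_gt0 q_lt1 q_noninc h0 hrn.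
move=> /le_lt_trans/(_ (LS_lt1 n)); rewrite -/(odds n) => Llt.
have : S n / 4 <= expR ((r n).+1%:R * odds n).
  rewrite -[leRHS]mul1r -ler_pdivrMr ?expR_gt0// -expRN.
  apply: le_trans (ltW Llt); rewrite ler_wpM2r ?expR_ge0//; lra.
rewrite -ler_ln ?posrE ?expR_gt0 ?divr_gt0// expRK ln_div ?posrE//.
move=> /(le_trans _); apply; rewrite lerD2l lerN2.
by have := @le_ln1Dx R 3 ltac:(lra); rewrite (_ : 1 + 3 = 4) -?natrD//; lra.
Unshelve. all: by end_near. Qed.

Lemma level_critical : critical q r.
Proof.
have c1 : (1 : R) @[_ --> \oo] --> (1 : R) by exact: cvg_cst.
have c3 : (3 : R) @[_ --> \oo] --> (3 : R) by exact: cvg_cst.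
(* The lower bound is [level_ge] rescaled by [q n / odds n], which tends to 1; the term
   [q n / ln (S n)] turns [(r n).+1] into [r n]. *)
apply: (@squeeze_cvgr _ _ _ _
  (fun n => (1 - 3 * (ln (S n))^-1) * (odds n / q n)^-1 - q n / ln (S n))
  (fun n => 1 + (ln (S n))^-1)).
- near=> n.
  have lS : 0 < ln (S n) by near: n.
  have k0 : 0 < odds n by near: n; exact: odds_gt0.
  apply/andP; split; last first.
    rewrite ler_pdivrMr// mulrDl mul1r mulVf ?gt_eqF//.
    by near: n; exact: level_le.
  have lb : ln (S n) - 3 <= (r n).+1%:R * odds n by near: n; exact: level_ge.
  rewrite ler_pdivlMr//.
  have qk : 0 < q n / odds n by rewrite divr_gt0.
  have lb' : (ln (S n) - 3) * (q n / odds n) <= (r n)%:R * q n + q n.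
    apply: (le_trans (ler_wpM2r (ltW qk) lb)); rewrite -natr1.
    by rewrite [leLHS](_ : _ = (r n)%:R * q n + q n)//; field; rewrite gt_eqF.
  rewrite [leLHS](_ : _ = (ln (S n) - 3) * (q n / odds n) - q n).
    by rewrite lerBlDr.
  by field; rewrite !gt_eqF.
- refine (near_eq_cvgn (cvgnB (cvgnM (cvgnB c1 (cvgnM c3 lnSV))
    (cvgnV (oner_neq0 _) odds_cvg)) q_lnS) _ _).
    by rewrite mulr0 !subr0 invr1 mulr1.
  by near=> n.
- refine (near_eq_cvgn (cvgnD c1 lnSV) (addr0 _) _); by near=> n.
Unshelve. all: by end_near. Qed.

(** One more toss changes [L] by a factor tending to 1, because [q n] tends to 0; and 1 lies between
    [L (r n).+1 n] and [L (r n) n]. *)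
Lemma level_mean_runs : L (r n) n @[n --> \oo] --> (1 : R).
Proof.
have q1 : 1%N%:R * q n @[n --> \oo] --> (0 : R).
  by refine (near_eq_cvgn q_cvg0 erefl _); near=> n; rewrite mul1r.
have := mean_runsD_ratio (critical_short level_critical) q1.
rewrite oppr0 expR0 => ratio1.
apply: (@squeeze_cvgr _ _ _ _ (fun=> 1)
  (fun n => (L (r n + 1) n / L (r n) n)^-1)).
- have h1 := short_le level_short.
  near=> n; rewrite L_ge1 /=.
  have rn : (4 * (r n).+1 <= n)%N by near: n; exact: h1.
  have L1 : 0 < L (r n + 1) n by apply: mean_runs_gt0; lia.
  rewrite invf_div ler_pdivlMr// addn1 ler_piMr ?(ltW (LS_lt1 n))//.
  exact: le_trans (L_ge1 n).
- exact: cvg_cst.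
- by refine (near_eq_cvgn (cvgnV (oner_neq0 _) ratio1) (invr1 _) _); near=> n.
Unshelve. all: by end_near. Qed.

Let critical_shift (k : nat -> nat) (z : R) :
  ((k n)%:R - (r n)%:R) * q n @[n --> \oo] --> z -> critical q k.
Proof.
move=> kz; refine (near_eq_cvgn (cvgnD level_critical (cvgnM kz lnSV)) _ _).
  by rewrite mulr0 addr0.
by near=> n; rewrite -mulrDl -mulrDl addrC subrK.
Unshelve. all: by end_near. Qed.

(** [mean_runsD_ratio] only lengthens runs. When [k] lies below [r], it is applied from [k] to [r]
    and inverted, hence the assumption of a fixed side. *)
Lemma level_shift (k : nat -> nat) (z : R) :
  (\forall n \near \oo, (r n <= k n)%N) \/
  (\forall n \near \oo, (k n <= r n)%N) ->
  ((k n)%:R - (r n)%:R) * q n @[n --> \oo] --> z ->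
  critical q k /\ L (k n) n @[n --> \oo] --> expR (- z).
Proof.
move=> rk kz; have ck := critical_shift kz; split=> //.
have cr := level_critical.
have L1 := level_mean_runs.
case: rk => rk.
  have sz : (k n - r n)%:R * q n @[n --> \oo] --> z.
    refine (near_eq_cvgn kz erefl _).
    by near=> n; rewrite natrB//; near: n.
  have ratio := mean_runsD_ratio (critical_short cr) sz.
  have h1 := short_le (critical_short cr).
  refine (near_eq_cvgn (cvgnM ratio L1) (mulr1 _) _).
  near=> n; have rkn : (r n <= k n)%N by near: n.
  rewrite divfK ?subnKC// gt_eqF// mean_runs_gt0//.
  by have : (4 * r n <= n)%N; [near: n; exact: h1|lia].
have sz : (r n - k n)%:R * q n @[n --> \oo] --> - z.
  refine (near_eq_cvgn (cvgnM (cvg_cst (-1 : R)) kz) (mulN1r _) _).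
  near=> n; have rkn : (k n <= r n)%N by near: n.
  by rewrite natrB// mulN1r -mulNr opprB.
have ratio := mean_runsD_ratio (critical_short ck) sz.
have e0 : expR (- - z) != 0 by rewrite gt_eqF ?expR_gt0.
have h1 := short_le (critical_short cr).
refine (near_eq_cvgn (cvgnM (cvgnV e0 ratio) L1) _ _).
  by rewrite mulr1 opprK expRN.
near=> n; have rkn : (k n <= r n)%N by near: n.
have rn : (4 * r n <= n)%N by near: n; exact: h1.
rewrite subnKC// invf_div divfK// gt_eqF// mean_runs_gt0//; lia.
Unshelve. all: by end_near. Qed.

Lemma level_threshold (z : R) : exists k : nat -> nat,
  [/\ critical q k, L (k n) n @[n --> \oo] --> expR (- z) &
      \forall n \near \oo, forall m : nat,
        (m%:R <= (q n)^-1 * z + (r n)%:R) = (m < k n)%N].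
Proof.
(* An integer is at most [z / q n] exactly when it is strictly below [floor (z / q n) + 1]. *)
pose f n : int := Num.floor (z / q n) + 1.
pose k n : nat := absz ((r n)%:Z + f n).
have f_cvg : (f n)%:~R * q n @[n --> \oo] --> z.
  apply: (@squeeze_cvgr _ _ _ _ (fun=> z) (fun n => z + q n)).
  - near=> n; have := floor_itv (z / q n); rewrite -/(f n) => /andP[f1 f2].
    apply/andP; split; first by rewrite -ler_pdivrMr// ltW.
    by rewrite -ler_pdivlMr// mulrDl divff ?gt_eqF// /f intrD lerD2r.
  - exact: cvg_cst.
  - refine (near_eq_cvgn (cvgnD (cvg_cst z) q_cvg0) (addr0 _) _); by near=> n.
(* The absolute value in [k] is eventually harmless: [r n * q n] diverges while [f n * q n] stays
   above [z - 1]. *)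
have kE : \forall n \near \oo, (k n)%:Z = (r n)%:Z + f n.
  have h1 := (cvgryPge _).1 (critical_cvgy level_critical) (1 - z).
  have h2 := cvgr_ge _ f_cvg (z - 1) ltac:(lra).
  near=> n; rewrite /k gez0_abs// -(ler_int R) intrD.
  rewrite -(pmulr_lge0 _ (q_gt0 n)) mulrDl.
  have : 1 - z <= (r n)%:R * q n by near: n; exact: h1.
  have : z - 1 <= (f n)%:~R * q n by near: n; exact: h2.
  lra.
have kz : ((k n)%:R - (r n)%:R) * q n @[n --> \oo] --> z.
  refine (near_eq_cvgn f_cvg erefl _); near=> n.
  have kn : (k n)%:Z = (r n)%:Z + f n by near: n.
  by rewrite -[(k n)%:R]/((k n)%:Z%:~R) kn intrD addrAC subrr add0r.
(* The sign of [z] decides the side. *)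
have rk : (\forall n \near \oo, (r n <= k n)%N) \/
          (\forall n \near \oo, (k n <= r n)%N).
  have [z0|z0] := leP 0 z; [left|right]; near=> n.
    have : 0 <= f n by rewrite addr_ge0// floor_ge0 divr_ge0.
    have : (k n)%:Z = (r n)%:Z + f n by near: n.
    lia.
  have : Num.floor (z / q n) < 0 by rewrite floor_lt0 pmulr_llt0 ?invr_gt0.
  have : (k n)%:Z = (r n)%:Z + f n by near: n.
  rewrite /f; lia.
have [ck Lk] := level_shift rk kz; exists k; split=> //.
near=> n => m.
have kn : (k n)%:Z = (r n)%:Z + f n by near: n.
have -> : (m < k n)%N = (m%:Z - (r n)%:Z <= Num.floor (z / q n)).
  by move: kn; rewrite /f; lia.
by rewrite floor_ge_int intrB lerBlDr mulrC.
Unshelve. all: by end_near. Qed.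
End Level.

End LongRuns.

(* Tail probabilities with toss 0 made a sure tail. *)
Definition virtual_tail (R : realType) (l : R -> R) (k : nat) : R :=
  if k == 0%N then 1 else l k%:R.

(** * From the function [l] to the sequence of tail probabilities *)

Section VirtualTail.
Variables (R : realType) (l : R -> R).
Hypothesis l_decr : forall s t : R, 0 < s -> s <= t -> l t <= l s.
Hypothesis l_prob : forall k : nat, (1 <= k)%N -> 0 < l k%:R < 1.
Local Notation q := (virtual_tail l).

Lemma virtual_tail_gt0 k : 0 < q k.
Proof. by case: k => // k; have /andP[] := l_prob (isT : (1 <= k.+1)%N). Qed.

Lemma virtual_tail_lt1 k : (0 < k)%N -> q k < 1.
Proof. by case: k => // k _; have /andP[] := l_prob (isT : (1 <= k.+1)%N). Qed.

Lemma virtual_tail_noninc m n : (m <= n)%N -> q n <= q m.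
Proof.
case: m n => [|m] [|n]// mn; first exact: ltW (virtual_tail_lt1 _).
by apply: l_decr; rewrite ?ltr0n// ler_nat.
Qed.

(* For n >= M, the real number n / (2M) lies below the integer n %/ M. *)
Lemma virtual_tail_slow : slowly_varying l ->
  forall M, (0 < M)%N -> q (n %/ M)%N / q n @[n --> \oo] --> (1 : R).
Proof.
move=> l_slow M M0; set lam : R := (2 * M%:R)^-1.
have lam0 : 0 < lam by rewrite invr_gt0 mulr_gt0 ?ltr0n.
have := cvg_comp _ _ (@cvgr_idn R) (l_slow lam lam0) => lim.
apply: (squeeze_cvgr _ (cvg_cst (1 : R)) lim).
near=> n; have Mn : (M <= n)%N by near: n; exact: nbhs_infty_ge.
have n0 : (0 < n)%N by exact: leq_trans Mn.
have d0 : (0 < n %/ M)%N by rewrite divn_gt0.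
have qn : q n = l n%:R by rewrite /virtual_tail gt_eqF.
have qd : q (n %/ M)%N = l (n %/ M)%N%:R by rewrite /virtual_tail gt_eqF.
apply/andP; split.
  rewrite ler_pdivlMr ?virtual_tail_gt0// mul1r.
  by rewrite virtual_tail_noninc// leq_div.
rewrite /= qd -qn ler_wpM2r ?invr_ge0 ?(ltW (virtual_tail_gt0 _))//.
apply: l_decr; first by rewrite mulr_gt0 ?ltr0n.
rewrite ler_pdivrMl ?mulr_gt0 ?ltr0n// -natrM -natrM ler_nat.
have := ltn_ceil n M0; rewrite mulSn; nia.
Unshelve. all: by end_near. Qed.

Lemma virtual_tail_cvg0 : l t @[t --> +oo] --> (0 : R) ->
  q n @[n --> \oo] --> (0 : R).
Proof.
move=> l_lim; have lim := cvg_comp _ _ (@cvgr_idn R) l_lim.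
refine (near_eq_cvgn lim erefl _).
near=> n; have n0 : (0 < n)%N by near: n; exact: nbhs_infty_gt.
by rewrite /= /virtual_tail gt_eqF.
Unshelve. all: by end_near. Qed.

Lemma virtual_tail_sum n :
  \sum_(1 <= k < n.+1) l k%:R = partial_sum q n.+1 - 1.
Proof.
rewrite big_add1 /partial_sum big_nat_recl//= addrC addKr.
by apply: eq_bigr.
Qed.
End VirtualTail.

(** Step back by one from the smallest length with mean below 1. Such a length exists, since length
    [n.+1] gives an empty sum; it is not 0, since length 0 gives at least [q 0 = 1]. *)
Lemma level_exists (R : realType) (q : nat -> R) : (forall k, 0 < q k) ->
  q 0%N = 1 -> exists r : nat -> nat,
  (forall n, 1 <= mean_runs q (r n) n) /\
  (forall n, mean_runs q (r n).+1 n < 1).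
Proof.
move=> q_gt0 q0.
have ex n : exists r, 1 <= mean_runs q r n /\ mean_runs q r.+1 n < 1.
  have mr : exists m, mean_runs q m n < 1.
    by exists n.+1; rewrite /mean_runs subnn big_geq.
  case: (ex_minnP mr) => -[|m] hm minm.
    move: hm; rewrite ltNge => /negP[]; rewrite /mean_runs subn0.
    rewrite big_nat_recl// q0 /heads_prob big_ord0 mulr1 lerDl.
    by apply: sumr_ge0 => i _; rewrite big_ord0 mulr1 ltW.
  exists m; split => //; rewrite leNgt; apply/negP => /minm; lia.
have [r hr] := choice ex.
by exists r; split=> n; have [] := hr n.
Qed.

Theorem theoremA1 (R : realType) (l : R -> R)
    (l_pos : forall t : R, 0 < t -> 0 < l t)
    (l_smooth : smooth_on_pos l)
    (l_slow : slowly_varying l)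
    (l_decr : forall s t : R, 0 < s -> s <= t -> l t <= l s)
    (l_lim : l t @[t --> +oo] --> (0 : R))
    (l_prob : forall k : nat, (1 <= k)%N -> 0 < l k%:R < 1)
    (d : measure_display) (T : measurableType d) (P : probability T R)
    (X : nat -> {RV P >-> bool})
    (X_indep : mutually_independent [set k | (1 <= k)%N] X)
    (X_tails : forall k : nat, (1 <= k)%N ->
       P (X k @^-1` [set true]) = (l k%:R)%:E)
    (X_heads : forall k : nat, (1 <= k)%N ->
       P (X k @^-1` [set false]) = (1 - l k%:R)%:E) :
  let Rn n w := longest_head_run (fun k => X k w) n in
  let EPi n : \bar R := ('E_P[fun w => (num_tails (fun k => X k w) n)%:R])%E in
  (forall n : nat, EPi n = (\sum_(1 <= k < n.+1) l k%:R)%:E) /\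
  exists a b : nat -> R,
    [/\ forall n, 0 < a n,
        asymp_equiv a (fun n => n%:R / fine (EPi n)),
        asymp_equiv b (fun n => n%:R * ln (fine (EPi n)) / fine (EPi n)) &
        forall z : R,
          P [set w | (Rn n w)%:R <= a n * z + b n] @[n --> \oo]
            --> (expR (- expR (- z)))%:E].
Proof.
move=> Rn EPi; set q := virtual_tail l.
have EPiE n : EPi n = (\sum_(1 <= k < n.+1) l k%:R)%:E.
  by apply: (expectation_num_tails (p := fun k => l k%:R)) => k; exact: X_tails.
split=> //.
have q_gt0 : forall k, 0 < q k := virtual_tail_gt0 l_prob.
have q_lt1 : forall k, (0 < k)%N -> q k < 1 := virtual_tail_lt1 l_prob.
have q_noninc : forall m n, (m <= n)%N -> q n <= q m :=
  virtual_tail_noninc l_decr l_prob.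
have q_slow := virtual_tail_slow l_decr l_prob l_slow; rewrite -/q in q_slow.
have q_cvg0 := virtual_tail_cvg0 l_lim; rewrite -/q in q_cvg0.
have [h [h_gt0 h_le q_h S_h]] := slow_scale q_gt0 q_noninc q_slow.
have [r [L_ge1 LS_lt1]] := level_exists q_gt0 erefl.
have r_crit := level_critical q_gt0 q_lt1 q_noninc q_slow q_cvg0 h_gt0 h_le q_h
  S_h L_ge1 LS_lt1.
set S := partial_sum q.
(* [S n.+1] runs over the indices 0 to [n]; the 1 removes the sure tail at index 0. *)
pose E n := S n.+1 - 1.
have fineE n : fine (EPi n) = E n by rewrite EPiE /= virtual_tail_sum.
have S_cvgy : S n @[n --> \oo] --> +oo.
  exact: (partial_sum_cvgy q_gt0 q_noninc q_slow).
have SV : (S n)^-1 @[n --> \oo] --> (0 : R).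
  apply/gtr0_cvgV0 => //.
  by exists 1%N => // n /=; exact: (partial_sum_gt0 q_gt0).
have E_S : E n / S n @[n --> \oo] --> (1 : R).
  have c1 : (1 : R) @[_ --> \oo] --> (1 : R) by exact: cvg_cst.
  (* Here [E n / S n = 1 + (q n - 1) / S n]. *)
  refine (near_eq_cvgn (cvgnD c1 (cvgnM (cvgnB q_cvg0 c1) SV)) _ _).
    by rewrite mulr0 addr0.
  near=> n; have n0 : (0 < n)%N by near: n; exact: nbhs_infty_gt.
  have Sn0 : 0 < S n by exact: (partial_sum_gt0 q_gt0).
  rewrite /E /S /partial_sum big_nat_recr//= -/(partial_sum q n) -/S.
  by field; rewrite gt_eqF.
have nq_S := karamata q_gt0 q_noninc q_slow.
have E_gt0 : \forall n \near \oo, 0 < E n.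
  have h1 := cvgr_gt _ E_S 0 ltr01; near=> n.
  have n0 : (0 < n)%N by near: n; exact: nbhs_infty_gt.
  have : 0 < E n / S n by near: n; exact: h1.
  by rewrite pmulr_lgt0// invr_gt0 (partial_sum_gt0 q_gt0).
have lnS_cvgy := cvgy_ln S_cvgy.
have lnS_gt0 := (cvgryPgt _).1 lnS_cvgy 0.
have lnE_S : ln (E n) / ln (S n) @[n --> \oo] --> (1 : R).
  have c1 : (1 : R) @[_ --> \oo] --> (1 : R) by exact: cvg_cst.
  have lnES : ln (E n / S n) @[n --> \oo] --> (0 : R).
    by rewrite -(ln1 R); apply: continuous_cvg => //; exact: continuous_ln.
  have lnSV : (ln (S n))^-1 @[n --> \oo] --> (0 : R).
    by apply/gtr0_cvgV0 => //; exact: lnS_gt0.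
  refine (near_eq_cvgn (cvgnD c1 (cvgnM lnES lnSV)) _ _).
    by rewrite mulr0 addr0.
  near=> n; have n0 : (0 < n)%N by near: n; exact: nbhs_infty_gt.
  have Sn0 : 0 < S n by exact: (partial_sum_gt0 q_gt0).
  have En0 : 0 < E n by near: n; exact: E_gt0.
  have lSn0 : 0 < ln (S n) by near: n; exact: lnS_gt0.
  by rewrite ln_div ?posrE//; field; rewrite gt_eqF.
(* Using [q] rather than [l] keeps [a 0] positive, as [q 0 = 1]. *)
exists (fun n => (q n)^-1), (fun n => (r n)%:R); split.
- by move=> n; rewrite invr_gt0.
- rewrite /asymp_equiv.
  refine (near_eq_cvgn (cvgnM E_S (cvgnV (oner_neq0 _) nq_S)) _ _).
    by rewrite invr1 mulr1.
  near=> n; have n0 : (0 < n)%N by near: n; exact: nbhs_infty_gt.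
  have Sn0 : 0 < S n by exact: (partial_sum_gt0 q_gt0).
  have En0 : 0 < E n by near: n; exact: E_gt0.
  rewrite fineE -/S; field.
  by rewrite pnatr_eq0 !gt_eqF.
- rewrite /asymp_equiv.
  (* The quotient factors into [r n * q n / ln (S n)], [E n / S n] and the inverses of
     [n * q n / S n] and [ln (E n) / ln (S n)], each tending to 1. *)
  refine (near_eq_cvgn (cvgnM (cvgnM r_crit
    (cvgnM E_S (cvgnV (oner_neq0 _) nq_S))) (cvgnV (oner_neq0 _) lnE_S)) _ _).
    by rewrite invr1 !mulr1.
  have h1 := cvgr_gt _ lnE_S 0 ltr01.
  near=> n; have n0 : (0 < n)%N by near: n; exact: nbhs_infty_gt.
  have Sn0 : 0 < S n by exact: (partial_sum_gt0 q_gt0).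
  have En0 : 0 < E n by near: n; exact: E_gt0.
  have lSn0 : 0 < ln (S n) by near: n; exact: lnS_gt0.
  have lEn0 : 0 < ln (E n).
    have : 0 < ln (E n) / ln (S n) by near: n; exact: h1.
    by rewrite pmulr_lgt0// invr_gt0.
  rewrite fineE -/S; field.
  by rewrite pnatr_eq0 !gt_eqF.
- move=> z.
  have [k [k_crit Lk thr]] := level_threshold q_gt0 q_lt1 q_noninc q_slow q_cvg0
    h_gt0 h_le q_h S_h L_ge1 LS_lt1 z.
  pose Q r' n := fine (P (no_head_run X r' n)).
  have Q_ge0 r' n : 0 <= Q r' n by rewrite fine_ge0.
  have q_tails j : (0 < j)%N -> P (X j @^-1` [set true]) = (q j)%:E.
    by move=> j0; rewrite /q /virtual_tail gt_eqF//; exact: X_tails.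
  have q_heads j : (0 < j)%N -> P (X j @^-1` [set false]) = (1 - q j)%:E.
    by move=> j0; rewrite /q /virtual_tail gt_eqF//; exact: X_heads.
  have Q_rec r' : (0 < r')%N -> Q r' 0%N = 1 /\
      forall n, Q r' n.+1 = Q r' n - run_end_prob q r' n.+1 * Q r' (n - r')%N.
    exact: (no_head_run_recurrence X_indep erefl q_tails q_heads).
  have lim := no_head_run_limit q_gt0 q_lt1 q_noninc q_slow h_gt0 h_le q_h S_h
    Q_ge0 Q_rec k_crit Lk.
  have evE : \forall n \near \oo,
      [set w | (Rn n w)%:R <= (q n)^-1 * z + (r n)%:R] = no_head_run X (k n) n.
    near=> n; have thr_n : forall m : nat,
        (m%:R <= (q n)^-1 * z + (r n)%:R) = (m < k n)%N by near: n.
    by apply/seteqP; split => w /=; rewrite thr_n.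
  have mQ r' n : measurable (no_head_run X r' n).
    (* For length 0 the event is empty, since no run length is below 0. *)
    have [->|r'0] := posnP r'; last first.
      exact: (measurable_no_head_run X_indep erefl q_tails q_heads).
    by rewrite (_ : no_head_run X 0 n = set0)//; apply/seteqP; split.
  apply: cvg_EFin.
    by near=> n; rewrite (near evE n)// fin_num_measure.
  refine (near_eq_cvgn lim erefl _).
  by near=> n; rewrite /= (near evE n).
Unshelve. all: by end_near. Qed.
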